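(* Let $f,L,g$ be continuous and assume that there are constants such that for all $x,y,z\in\mathbb{R}^d$, $u\in U$, $s\in[0,T]$ and all $t\in[0,T]$, $\tau>0$ with $t-\tau,t+\tau\in[0,T]$: (i) $|f(x,u,s)|\le M_f$, $|L(x,u,s)|\le M_L$, $|g(x)|\le M_g$; (ii) $|f(x,u,s)-f(y,u,s)|\le L_f|x-y|$ and $|L(x,u,s)-L(y,u,s)|\le L_L|x-y|$; (iii) $|g(x)-g(y)|\le L_g|x-y|$; (iv) $L$ and $g$ are semiconcave: $L(x+z,u,t+\tau)-2L(x,u,t)+L(x-z,u,t-\tau)\le C_L(|z|^2+\tau^2)$ and $g(x+z)-2g(x)+g(x-z)\le C_g|z|^2$; (v) $f(x,u,t)$ is Lipschitz continuous in space and time, uniformly in $u$; (vi) $|f(x+z,u,t+\tau)-2f(x,u,t)+f(x-z,u,t-\tau)|\le C_f(|z|^2+\tau^2)$. Let $v$ be the value function and $V$ the discrete value function with time step $\Delta t$. Then $$\sup_{(x,t)\in\mathbb{R}^d\times[0,T]}\big(V(x,t)-v(x,t)\big)\le \overline C(T)\,\Delta t,$$ where $\overline C(T)$ is a constant not depending on $\Delta t$.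
   Context: Fix $T>0$, $\lambda\ge 0$, integers $d,m\ge1$ and a compact set $U\subset\mathbb{R}^m$. The data are a vector field $f:\mathbb{R}^d\times\mathbb{R}^m\times[0,T]\to\mathbb{R}^d$, a running cost $L:\mathbb{R}^d\times\mathbb{R}^m\times[0,T]\to\mathbb{R}$ (arguments: state, control, time) and a final cost $g:\mathbb{R}^d\to\mathbb{R}$. For $(x,t)\in\mathbb{R}^d\times[0,T]$ let $\mathcal{U}$ be the set of measurable $u:[t,T]\to U$; it is assumed that for each $u\in\mathcal{U}$ there is a unique solution $y(\cdot)=y(\cdot;u,x,t)$ of $\dot y(s)=f(y(s),u(s),s)$, $s\in(t,T]$, $y(t)=x$. The cost and value function are $$J_{x,t}(u)=\int_t^T L(y(s),u(s),s)e^{-\lambda(s-t)}ds+g(y(T))e^{-\lambda(T-t)},\qquad v(x,t)=\inf_{u\in\mathcal{U}}J_{x,t}(u).$$ Time grid: for $\overline N\in\mathbb{N}$, $\Delta t=T/\overline N$, $t_n=n\Delta t$, $n=0,\dots,\overline N$. For an initial time $s\in[t_n,t_{n+1})$, $\mathcal{U}^\Delta$ is the set of controls with values in $U$ that are constant on each grid interval: $u=\sum_{k=n}^{\overline N-1}u^k\chi_{[t_k,t_{k+1})}$, $u^k\in U$. The explicit Euler scheme from $(x,s)$ is $y^{n+1}=x+(t_{n+1}-s)f(x,u^n,s)$ and $y^{k+1}=y^k+\Delta t\,f(y^k,u^k,t_k)$ for $k\ge n+1$. The discrete cost is $$J^{\Delta t}_{x,s}(u)=(t_{n+1}-s)L(x,u^n,s)+\Delta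 t\sum_{k=n+1}^{\overline N-1}L(y^k,u^k,t_k)e^{-\lambda(t_k-s)}+g(y^{\overline N})e^{-\lambda(T-s)},$$ and the discrete value function is $V(x,s)=\inf_{u\in\mathcal{U}^\Delta}J^{\Delta t}_{x,s}(u)$ for $s<T$, $V(x,T)=g(x)$. Equivalently, $V(x,s)=\min_{u\in U}\{e^{-\lambda(t_{n+1}-s)}V(x+(t_{n+1}-s)f(x,u,s),t_{n+1})+(t_{n+1}-s)L(x,u,s)\}$ for $s\in[t_n,t_{n+1})$. *)

(* Defs.v *)
From HB Require Import structures.
From mathcomp Require Import all_boot all_order all_algebra.
From mathcomp Require Import all_classical all_reals all_analysis.

Set Implicit Arguments.
Unset Strict Implicit.
Unset Printing Implicit Defensive.

Import Order.TTheory GRing.Theory Num.Theory.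
Import numFieldNormedType.Exports.

Local Open Scope classical_set_scope.
Local Open Scope ring_scope.

(* The Euclidean norm; the library's norm on row vectors is the max norm. *)
Definition enorm (R : realType) (n : nat) (x : 'rV[R]_n) : R :=
  Num.sqrt (\sum_(i < n) x ord0 i ^+ 2).

Section ContinuousProblem.
Context {R : realType} {d m : nat}.
Variables (T lambda : R) (U : set 'rV[R]_m).
Variables (f : 'rV[R]_d -> 'rV[R]_m -> R -> 'rV[R]_d).
Variables (L : 'rV[R]_d -> 'rV[R]_m -> R -> R) (g : 'rV[R]_d -> R).

(* Measurability of a vector-valued map is measurability of its coordinates.
   A control is a total function of which only the values on [t, T] matter. *)
Definition admissible (t : R) : set (R -> 'rV[R]_m) :=
  [set u | (forall s, t <= s <= T -> U (u s)) /\
           (forall i : 'I_m, measurable_fun `[t, T] (fun s => u s ord0 i))].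

(* As u is only measurable, y' = f(y, u, s), y(t) = x is understood in the
   sense of Caratheodory. *)
Definition is_solution (u : R -> 'rV[R]_m) (x : 'rV[R]_d) (t : R)
    (y : R -> 'rV[R]_d) : Prop :=
  [/\ {within `[t, T], continuous y},
      forall i : 'I_d, lebesgue_measure.-integrable `[t, T]
        (fun r => (f (y r) (u r) r ord0 i)%:E) &
      forall s, t <= s <= T -> forall i : 'I_d,
        y s ord0 i = x ord0 i +
          \int[lebesgue_measure]_(r in `[t, s]) f (y r) (u r) r ord0 i].

(* For each control and each initial datum, y u x t is the unique solution. *)
Definition is_solution_map
    (y : (R -> 'rV[R]_m) -> 'rV[R]_d -> R -> R -> 'rV[R]_d) : Prop :=
  forall (t : R) (x : 'rV[R]_d) (u : R -> 'rV[R]_m),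
    0 <= t <= T -> admissible t u ->
    is_solution u x t (y u x t) /\
    forall z, is_solution u x t z -> forall s, t <= s <= T -> z s = y u x t s.

Variable y : (R -> 'rV[R]_m) -> 'rV[R]_d -> R -> R -> 'rV[R]_d.

Definition cost (x : 'rV[R]_d) (t : R) (u : R -> 'rV[R]_m) : R :=
  \int[lebesgue_measure]_(s in `[t, T])
     (L (y u x t s) (u s) s * expR (- (lambda * (s - t))))
  + g (y u x t T) * expR (- (lambda * (T - t))).

Definition value (x : 'rV[R]_d) (t : R) : R :=
  inf [set cost x t u | u in admissible t].

End ContinuousProblem.

Section DiscreteProblem.
Context {R : realType} {d m : nat}.
Variables (T lambda : R) (U : set 'rV[R]_m).
Variables (f : 'rV[R]_d -> 'rV[R]_m -> R -> 'rV[R]_d).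
Variables (L : 'rV[R]_d -> 'rV[R]_m -> R -> R) (g : 'rV[R]_d -> R).
Variable N : nat.

Definition time_step : R := T / N%:R.

Definition node (n : nat) : R := n%:R * time_step.

(* The n such that s lies in [t_n, t_(n+1)), for s >= 0. *)
Definition grid_index (s : R) : nat := Num.truncn (s / time_step).

(* A piecewise constant control is represented by its values u^k, n <= k < N. *)
Definition discrete_admissible (s : R) : set (nat -> 'rV[R]_m) :=
  [set u | forall k, (grid_index s <= k < N)%N -> U (u k)].

(* euler x s u k is y^k; it is meaningful for k > grid_index s only. *)
Fixpoint euler (x : 'rV[R]_d) (s : R) (u : nat -> 'rV[R]_m) (k : nat)
    : 'rV[R]_d :=
  if k is j.+1 then
    if (j <= grid_index s)%N then
      x + (node (grid_index s).+1 - s) *: f x (u (grid_index s)) s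
    else euler x s u j + time_step *: f (euler x s u j) (u j) (node j)
  else x.

Definition discrete_cost (x : 'rV[R]_d) (s : R) (u : nat -> 'rV[R]_m) : R :=
  let n := grid_index s in
  (node n.+1 - s) * L x (u n) s
  + time_step * (\sum_(n.+1 <= k < N)
      L (euler x s u k) (u k) (node k) * expR (- (lambda * (node k - s))))
  + g (euler x s u N) * expR (- (lambda * (T - s))).

Definition discrete_value (x : 'rV[R]_d) (s : R) : R :=
  if s < T then inf [set discrete_cost x s u | u in discrete_admissible s]
  else g x.

End DiscreteProblem.

(* Main.v *)
Require Import Defs.
From HB Require Import structures.
From mathcomp Require Import all_boot all_order all_algebra.
From mathcomp Require Import all_classical all_reals all_analysis.
From mathcomp Require Import measurable_realfun.
From mathcomp Require Import ring lra.

(* Let W_n(x) = exp(- lambda t_n) V(x, t_n) and h the time step. Uniformly in n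
   and h, W_n is Lipschitz and semiconcave in x, and
     W_n(x) <= h exp(- lambda t_n) L(x, v, t_n) + W_(n+1)(x + h f(x, v, t_n))
   for every v in U. Given a trajectory y with a merely measurable control u,
   average this over v = u(s), s in a window [a, a + h], at x = y(a): by Jensen's
   inequality for the semiconcave W_(n+1), the mean of
   W_(n+1)(y(a) + h f(y(s), u(s), s)) is at most W_(n+1)(y(a + h)) + O(h^2), since
   y(a + h) is the mean of the arguments. Summing over the windows gives
   V <= J(u) + O(h).
   L need not be Lipschitz in time, but a bounded semiconcave function of time
   has its slope bounded below away from T and bounded above away from 0, and
   only one of the two bounds is needed if all times s of the window lie on the
   same side of t_n. So the windows are [t_n, t_(n+1)] as long as t_n <= T/2 and
   [t_(n-1), t_n] afterwards; the lag of one step costs O(h). *)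

Set Implicit Arguments.
Unset Strict Implicit.
Unset Printing Implicit Defensive.

Import Order.TTheory GRing.Theory Num.Theory.
Import numFieldNormedType.Exports.

Local Open Scope classical_set_scope.
Local Open Scope ring_scope.

(** * Measurability of compositions *)

Section measurable_base.
Context {R : realType}.
Implicit Types (D : set R).

(** The sets [B i] form a countable network of [X]: every open set is a union of some of them. In
    this form measurability passes to pairs of maps through products of such sets, with no
    sigma-algebra on [X]. *)
Definition measurable_base (X : topologicalType) D (z : R -> X) :=
  exists (I : countType) (B : I -> set X),
    (forall i, measurable (D `&` z @^-1` B i)) /\
    (forall x O, nbhs x O -> exists i, B i x /\ B i `<=` O).

(** An open set is the union of the [B i] that it contains, and there are countably many of them. *)
Lemma measurable_base_open (X : topologicalType) D (z : R -> X) (O : set X) :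
  measurable_base D z -> open O -> measurable (D `&` z @^-1` O).
Proof.
move=> [I [B [mB Bnb]]] oO.
have -> : D `&` z @^-1` O = \bigcup_(i in [set i | B i `<=` O]) (D `&` z @^-1` B i).
  apply/seteqP; split => [s [Ds Os]|s [i /= BO [Ds Bs]]]; last by split => //; exact: BO.
  have [i [Bi BO]] := Bnb _ _ (open_nbhs_nbhs (conj oO Os)).
  by exists i.
rewrite bigcup_mkcond; apply: countable_bigcupT_measurable => [|i].
  exact: countableP.
by case: ifP.
Qed.

Lemma measurable_base_prod (X Y : topologicalType) D (z : R -> X) (w : R -> Y) :
  measurable_base D z -> measurable_base D w ->
  measurable_base D (fun s => (z s, w s)).
Proof.
move=> [I [B [mB Bnb]]] [J [C [mC Cnb]]].
exists (I * J)%type, (fun ij => B ij.1 `*` C ij.2); split => [[i j]|[x y] O].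
  have -> : D `&` (fun s => (z s, w s)) @^-1` (B i `*` C j) =
     (D `&` z @^-1` B i) `&` (D `&` w @^-1` C j).
    by apply/seteqP; split => s /=; tauto.
  exact: measurableI.
move=> [[P Q] /= [nP nQ] PQ].
have [i [Bi BP]] := Bnb _ _ nP; have [j [Cj CQ]] := Cnb _ _ nQ.
exists (i, j); split => // -[a b] /= [Ba Cb]; apply: PQ; split => /=.
  exact: BP.
exact: CQ.
Qed.

Lemma rat_near (x e : R) : 0 < e -> exists q : rat, `|x - ratr q| < e.
Proof.
move=> e0; have [q] := @rat_in_itvoo R (x - e) (x + e) ltac:(lra).
rewrite in_itv /= => /andP[q1 q2]; exists q.
by rewrite ltr_norml; lra.
Qed.

Lemma mx_norm_ltP (m n : nat) (x : 'M[R]_(m, n)) (e : R) : 0 < e ->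
  (forall i j, `|x i j| < e) -> `|x| < e.
Proof.
move=> e0 xe; rewrite /Num.norm /= mx_normrE.
by apply: bigmax_lt => // -[i j] _; exact: xe.
Qed.

(** The network consists of the cubes with rational centre and radius [1 / (k + 1)]; the preimage of
    a cube is a finite intersection of preimages under coordinates. *)
Lemma measurable_base_rV (n : nat) D (z : R -> 'rV[R]_n) :
  measurable D -> (forall i, measurable_fun D (fun s => z s ord0 i)) ->
  measurable_base D z.
Proof.
move=> mD mz.
exists ('rV[rat]_n * nat)%type, (fun qk : 'rV[rat]_n * nat => [set x : 'rV[R]_n |
  forall i, ball (ratr (qk.1 ord0 i) : R) qk.2.+1%:R^-1 (x ord0 i)]); split.
  move=> [q k] /=.
  have -> : D `&` z @^-1` [set x : 'rV[R]_n |
      forall i, ball (ratr (q ord0 i) : R) k.+1%:R^-1 (x ord0 i)] =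
    D `&` \bigcap_(i in [set: 'I_n]) (D `&` (fun s => z s ord0 i) @^-1`
      (ball (ratr (q ord0 i) : R) k.+1%:R^-1)).
    apply/seteqP; split => [s [Ds zs]|s [Ds zs]]; split => // i.
      by move=> _; split => //; exact: zs.
    by have [] := zs i I.
  apply: measurableI => //; apply: fin_bigcap_measurable => // i _.
  by apply: mz => //; exact: measurable_ball.
move=> x O /nbhs_ballP[e /= e0 xO].
have [k] := ltr_add_invr e0; rewrite add0r => ke.
(* The radius is halved because the centre [q] is only close to [x]: a point of the cube is within
   twice the radius of [x]. *)
have [|k' k'k] := @ltr_add_invr R 0 (k.+1%:R^-1 / 2); first by rewrite divr_gt0.
rewrite add0r in k'k.
pose q := \row_i xchoose (rat_near (x ord0 i) (e := k'.+1%:R^-1) ltac:(by [])).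
have qE i : `|x ord0 i - ratr (q ord0 i)| < k'.+1%:R^-1.
  rewrite mxE; exact: (xchooseP (rat_near _ _)).
exists (q, k'); split => /= [i|z' z'q]; first by rewrite /ball /= distrC.
apply: xO; rewrite -ball_normE /=; apply: mx_norm_ltP => // i j.
have -> : i = ord0 by exact: ord1.
rewrite !mxE; have := qE j; have := z'q j.
move: (k'.+1%:R^-1) (k.+1%:R^-1) (ratr (q ord0 j) : R) k'k ke => a b c.
by rewrite /ball /= /ball_ /= !ltr_norml; lra.
Qed.

Lemma measurable_base_R D (z : R -> R) :
  measurable D -> measurable_fun D z -> measurable_base D z.
Proof.
move=> mD mz.
exists (rat * nat)%type, (fun qk => ball (ratr qk.1 : R) qk.2.+1%:R^-1); split.
  by move=> [q k]; apply: mz => //; exact: measurable_ball.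
move=> x O /nbhs_ballP[e /= e0 xO].
have [|k ke] := @ltr_add_invr R 0 (e / 2); first by rewrite divr_gt0.
rewrite add0r in ke.
have [q qE] := rat_near x (e := k.+1%:R^-1) ltac:(by []).
exists (q, k); split => /= [|w]; first by rewrite /ball /= distrC.
rewrite /ball /= => wq; apply: xO; rewrite /ball /=.
move: (k.+1%:R^-1) (ratr q : R) ke qE wq => a b ke.
by rewrite /ball_ /= !ltr_norml; lra.
Qed.

(** For [F] continuous within [A], the preimage of an open interval is the trace on [A] of an open
    set [V]; as [z] stays in [A], only [V] matters. This serves for [L] along a trajectory, where
    [A] restricts the time to [[0, T]]. *)
Lemma measurable_base_comp (X : topologicalType) D (z : R -> X) (A : set X)
    (F : X -> R) :
  measurable_base D z -> (forall s, D s -> A (z s)) ->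
  {within A, continuous F} -> measurable_fun D (F \o z).
Proof.
move=> mz zA cF; apply: (measurability _ (RGenOpens.measurableE R)).
move=> _ [_ [a [b ->] <-]].
have oab : open `]a, b[%classic by exact: interval_open.
have /continuousP/(_ _ oab) := cF.
move=> /open_subspaceP[V oV VA].
have -> : D `&` (F \o z) @^-1` `]a, b[%classic = D `&` z @^-1` V.
  apply/seteqP; split => [s [Ds Fzs]|s [Ds Vzs]]; split => //.
    by have [] : (V `&` A) (z s) by rewrite VA; split => //; exact: zA.
  suff: ((F @^-1` `]a, b[%classic) `&` A) (z s) by case.
  by rewrite -VA; split => //; exact: zA.
exact: measurable_base_open.
Qed.
End measurable_base.

(** * Semiconcave functions *)

Section row_vectors.
Context {R : realType} {d : nat}.
Implicit Types x y z w p : 'rV[R]_d.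

Definition dot x y : R := \sum_(i < d) x ord0 i * y ord0 i.
Definition sqn x : R := \sum_(i < d) x ord0 i ^+ 2.

Lemma coord_le_norm x i : `|x ord0 i| <= `|x|.
Proof.
rewrite [leRHS]/Num.norm /= mx_normrE.
by rewrite (le_bigmax _ (fun ij : 'I_1 * 'I_d => `|x ij.1 ij.2|) (ord0, i)).
Qed.

Lemma norm_leP x (e : R) : 0 <= e -> (forall i, `|x ord0 i| <= e) -> `|x| <= e.
Proof.
move=> e0 xe; rewrite /Num.norm /= mx_normrE.
apply: bigmax_le => // -[i j] _ /=.
by have -> : i = ord0 by exact: ord1.
Qed.

Lemma sqn_ge0 x : 0 <= sqn x.
Proof. by apply: sumr_ge0 => i _; exact: sqr_ge0. Qed.

Lemma sqnZ a x : sqn (a *: x) = a ^+ 2 * sqn x.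
Proof. by rewrite /sqn mulr_sumr; apply: eq_bigr => i _; rewrite mxE exprMn. Qed.

Lemma sqnD x y : sqn (x + y) = sqn x + 2 * dot x y + sqn y.
Proof.
rewrite /sqn /dot mulr_sumr -!big_split /=; apply: eq_bigr => i _.
by rewrite mxE; ring.
Qed.

Lemma sqn_le_norm x : sqn x <= d%:R * `|x| ^+ 2.
Proof.
apply: (@le_trans _ _ (\sum_(i < d) `|x| ^+ 2)).
  apply: ler_sum => i _; rewrite -real_normK ?num_real//.
  by rewrite lerXn2r ?nnegrE// coord_le_norm.
by rewrite sumr_const card_ord mulr_natl.
Qed.

Lemma norm_le_sqn x : `|x| ^+ 2 <= sqn x.
Proof.
rewrite -(@ler_sqrt _ _ (sqn x)) ?sqn_ge0// sqrtr_sqr ger0_norm//.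
apply: norm_leP => [|i]; first exact: sqrtr_ge0.
rewrite -sqrtr_sqr ler_sqrt ?sqn_ge0// /sqn (bigD1 i)//= lerDl.
by apply: sumr_ge0 => j _; exact: sqr_ge0.
Qed.

Lemma sqn0 : sqn 0 = 0.
Proof. by apply: big1 => i _; rewrite mxE expr0n. Qed.

Lemma dotZl a x y : dot (a *: x) y = a * dot x y.
Proof. by rewrite /dot mulr_sumr; apply: eq_bigr => i _; rewrite mxE mulrA. Qed.

Lemma dotZr a x y : dot x (a *: y) = a * dot x y.
Proof. by rewrite /dot mulr_sumr; apply: eq_bigr => i _; rewrite mxE mulrCA. Qed.

Lemma dotxx x : dot x x = sqn x.
Proof. by apply: eq_bigr => i _; rewrite expr2. Qed.

Lemma sqn_continuous : continuous sqn.
Proof.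
apply: continuous_big => [|i _ x]; first exact: add_continuous.
apply: (@continuous_comp _ _ _ (fun y : 'rV[R]_d => y ord0 i) (fun t => t ^+ 2)).
  exact: coord_continuous.
exact: exprn_continuous.
Qed.

End row_vectors.

(** * Approximate supergradients of Lipschitz semiconcave functions *)

Section supergradient.
Context {R : realType} {d : nat} (phi : 'rV[R]_d -> R) (A K : R).
Hypotheses (A_ge0 : 0 <= A) (K_gt0 : 0 < K).
Hypothesis phi_lip : forall x z, `|phi x - phi z| <= A * `|x - z|.
Hypothesis phi_sc : forall x w, phi (x + w) - 2 * phi x + phi (x - w) <= K * sqn w.

Lemma lip_continuous : continuous phi.
Proof.
have A1 : 0 < A + 1 by apply: ltr_wpDl.
move=> x; apply/(@cvgrPdist_lt _ _ _ (nbhs x)) => e e0.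
apply/nbhs_ballP; exists (e / (A + 1)); first by rewrite /= divr_gt0.
move=> z; rewrite -ball_normE /= ltr_pdivlMr// => xz.
apply: le_lt_trans (phi_lip _ _) _; apply: le_lt_trans xz.
by rewrite [leRHS]mulrC ler_wpM2r//; lra.
Qed.

(* Semiconcavity on [z, z + w] improves the constant K / 2 + r in a quadratic
   upper bound to K / 2 + r / 2. *)
Lemma semiconcave_quadratic z p (c : R) :
  (forall w, phi (z + w) <= phi z + dot p w + c * sqn w) ->
  forall w, phi (z + w) <= phi z + dot p w + K * sqn w.
Proof.
move=> H.
have step r : (forall w, phi (z + w) <= phi z + dot p w + (K / 2 + r) * sqn w) ->
    forall w, phi (z + w) <= phi z + dot p w + (K / 2 + r / 2) * sqn w.
  move=> Hr w; have := Hr (2^-1 *: w); have := phi_sc (z + 2^-1 *: w) (2^-1 *: w).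
  have -> : z + 2^-1 *: w + 2^-1 *: w = z + w.
    by rewrite -addrA -scalerDl [2^-1 + 2^-1](_ : _ = 1) ?scale1r//; lra.
  rewrite addrK dotZr sqnZ.
  move: (sqn w) (dot p w) => q1 q2; lra.
have stepn n : forall w, phi (z + w) <=
    phi z + dot p w + (K / 2 + (c - K / 2) / 2 ^+ n) * sqn w.
  elim: n => [w|n IHn w].
    by rewrite expr0 divr1 [K / 2 + _]addrC subrK.
  have := step _ IHn w.
  by rewrite exprSr invfM mulrA.
move=> w.
(* Any [n] with [n + 1 > |c| / (K / 2)] will do, since [2 ^ n >= n + 1]. *)
have [n nK] : exists n, (c - K / 2) / 2 ^+ n <= K / 2.
  exists (Num.truncn (`|c| / (K / 2))).
  set n := Num.truncn _.
  have n2 : n.+1%:R <= 2 ^+ n :> R by rewrite -natrX ler_nat ltn_expl.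
  have cn : `|c| / (K / 2) < n.+1%:R by exact: truncnS_gt.
  have K2 : 0 < K / 2 by rewrite divr_gt0.
  rewrite ler_pdivrMr ?exprn_gt0//; rewrite ltr_pdivrMr// in cn.
  have c1 : c <= `|c| := ler_norm c.
  apply: (@le_trans _ _ `|c|); first by rewrite lerBlDr (le_trans c1)// lerDl ltW.
  by rewrite mulrC; apply: (le_trans (ltW cn)); rewrite ler_wpM2r// ltW.
apply: le_trans (stepn n w) _.
rewrite lerD2l ler_wpM2r ?sqn_ge0//.
by apply: le_trans (lerD (lexx _) nK) _; rewrite -splitr.
Qed.

(* The supergradient is taken at a maximizer z of phi - sqn (. - yb) / e. *)
Lemma approx_supergradient (yb : 'rV[R]_d) (delta : R) : 0 < delta ->
  exists z p, [/\ `|z - yb| <= delta, dot p (yb - z) <= 0 &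
    forall w, phi (z + w) <= phi z + dot p w + K * sqn w].
Proof.
move=> delta0.
pose e := delta / (A + 1).
have A1 : 0 < A + 1 by apply: ltr_wpDl.
have e0 : 0 < e by rewrite divr_gt0.
pose F z := phi z - sqn (z - yb) / e.
have Fc : continuous F.
  move=> z.
  have cz : {for z, continuous (fun z : 'rV[R]_d => sqn (z - yb))}.
    apply: (@continuous_comp _ _ _ (fun z : 'rV[R]_d => z - yb) sqn); last first.
      exact: sqn_continuous.
    by apply: (@continuousB _ _ _ idfun (fun=> yb)); [exact: cvg_id|exact: cst_continuous].
  apply: (@continuousB _ _ _ phi (fun z => sqn (z - yb) / e)).
    exact: lip_continuous.
  by apply: (@continuousM _ _ _ (fun=> e^-1)); [exact: cz|exact: cst_continuous].
pose B := closed_ball_ (@Num.norm _ _) yb delta.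
have Byb : B yb by rewrite /B /closed_ball_ /= subrr normr0 ltW.
have [|||zs] := @EVT_max_rV R d F B; first by exists yb.
- apply: bounded_closed_compact; last exact: closed_closed_ball_.
  exists (`|yb| + delta); split; first exact: num_real.
  move=> M yM z; rewrite /B /closed_ball_ /= => zd.
  have := ler_normD (z - yb) yb; rewrite subrK distrC => h.
  by lra.
- exact: continuous_subspaceT.
rewrite inE => Bzs zsmax.
have he : delta * e^-1 = A + 1 by rewrite /e invf_div mulrCA divff ?mulr1// gt_eqF.
have ie0 : 0 < e^-1 by rewrite invr_gt0.
(* The maximum over the ball is global by the choice of [e]: at a distance [rho > delta] from [yb]
   the penalty is at least [rho * delta / e = (A + 1) * rho], more than the gain [A * rho] that the
   Lipschitz bound allows. *)
have zmax z : F z <= F zs.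
  have [zd|zd] := leP `|yb - z| delta; first by apply: zsmax; rewrite inE.
  apply: (@le_trans _ _ (F yb)); last by apply: zsmax; rewrite inE.
  rewrite /F subrr sqn0 mul0r subr0.
  have h1 := ler_norm (phi z - phi yb); have h2 := phi_lip z yb.
  have h3 := norm_le_sqn (z - yb); rewrite distrC in zd.
  have h4 : `|z - yb| ^+ 2 / e <= sqn (z - yb) / e by rewrite ler_wpM2r// ltW.
  have h5 : `|z - yb| * (delta / e) <= `|z - yb| ^+ 2 / e.
    by rewrite expr2 mulrA ler_wpM2r ?(ltW ie0)// ler_wpM2l// ltW.
  by rewrite he in h5; lra.
(* The supergradient is the gradient of the penalty at [zs]; it points from [yb] to [zs], whence the
   sign of [dot p (yb - z)]. *)
exists zs, ((2 / e) *: (zs - yb)); split.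
- by rewrite distrC; exact: Bzs.
- rewrite -(opprB zs yb) -[- (zs - yb)]scaleN1r dotZl dotZr dotxx.
  have := sqn_ge0 (zs - yb); move: (sqn _) => q q0.
  by rewrite mulrCA mulN1r oppr_le0 mulr_ge0// mulr_ge0// ltW.
(* Maximality alone gives the quadratic bound with the constant [1 / e], which blows up with
   [1 / delta]; semiconcavity brings it down to [K]. *)
apply: (@semiconcave_quadratic _ _ e^-1) => w.
have := zmax (zs + w); rewrite /F.
have -> : zs + w - yb = (zs - yb) + w by rewrite addrAC.
rewrite sqnD dotZl.
move: (sqn (zs - yb)) (dot _ _) (sqn w) (phi _) (phi _) (e^-1) => a b c f1 f2 k.
by rewrite -mulrA; lra.
Qed.
End supergradient.

(** * Integration on intervals and Jensen's inequality for semiconcave functions *)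

Section jensen.
Context {R : realType}.
Notation mu := (@lebesgue_measure R).

Lemma Rintegral_sum (I : Type) (r : seq I) (D : set R) (f : I -> R -> R) :
  measurable D -> (forall i, mu.-integrable D (EFin \o f i)) ->
  mu.-integrable D (EFin \o (fun s => \sum_(i <- r) f i s)) /\
  \int[mu]_(s in D) (\sum_(i <- r) f i s) = \sum_(i <- r) \int[mu]_(s in D) f i s.
Proof.
move=> mD fi.
have si l : mu.-integrable D (EFin \o (fun s => \sum_(i <- l) f i s)).
  have : mu.-integrable D (fun s => \sum_(i <- l) (EFin \o f i) s)%E.
    by apply: integrable_sum => // i _; exact: fi.
  by apply: eq_integrable => // s _ /=; rewrite sumEFin.
split=> //; elim: r => [|i r IH].
  under eq_Rintegral do rewrite big_nil.
  by rewrite big_nil Rintegral_cst// mul0r.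
under eq_Rintegral do rewrite big_cons.
by rewrite big_cons RintegralD// IH.
Qed.

Lemma integrableRD (a b : R) (f g : R -> R) :
  mu.-integrable `[a, b] (EFin \o f) -> mu.-integrable `[a, b] (EFin \o g) ->
  mu.-integrable `[a, b] (EFin \o (fun s => f s + g s)).
Proof.
move=> fi gi; have : mu.-integrable `[a, b] ((EFin \o f) \+ (EFin \o g))%E.
  exact: integrableD.
by apply: eq_integrable => // s _ /=.
Qed.

Lemma integrableRB (a b : R) (f g : R -> R) :
  mu.-integrable `[a, b] (EFin \o f) -> mu.-integrable `[a, b] (EFin \o g) ->
  mu.-integrable `[a, b] (EFin \o (fun s => f s - g s)).
Proof.
move=> fi gi; have : mu.-integrable `[a, b] ((EFin \o f) \- (EFin \o g))%E.
  exact: integrableB.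
by apply: eq_integrable => // s _ /=.
Qed.

Lemma integrableRZl (a b k : R) (f : R -> R) :
  mu.-integrable `[a, b] (EFin \o f) ->
  mu.-integrable `[a, b] (EFin \o (fun s => k * f s)).
Proof.
move=> fi; have : mu.-integrable `[a, b] (fun s => k%:E * (EFin \o f) s)%E.
  exact: integrableZl.
by apply: eq_integrable => // s _ /=.
Qed.

Lemma integrable_cst_itv (a b c : R) : mu.-integrable `[a, b] (EFin \o (fun=> c)).
Proof.
apply: measurable_bounded_integrable => //.
  by rewrite /= lebesgue_measure_itv /=; case: ifP => _; rewrite -?EFinB ltry.
by exists `|c|; split; [exact: num_real|move=> M cM s _ /=; exact: ltW].
Qed.

Lemma Rintegral_cst_itv (a b c : R) : a <= b -> \int[mu]_(_ in `[a, b]) c = c * (b - a).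
Proof.
move=> ab; rewrite Rintegral_cst//= lebesgue_measure_itv /= lte_fin.
by case: ltP ab => [_ _|ba ab]; rewrite -?EFinB//= (@le_anti _ _ a b) ?ab// subrr.
Qed.

Lemma Rintegral_itv_split (a b c : R) (w : R -> R) : a <= b -> b <= c ->
  mu.-integrable `[a, c] (EFin \o w) ->
  \int[mu]_(s in `[a, c]) w s =
  \int[mu]_(s in `[a, b]) w s + \int[mu]_(s in `[b, c]) w s.
Proof.
move=> ab bc wi.
have := @Rintegral_itvB R w (BLeft a) (BRight c) b wi.
rewrite !bnd_simp => /(_ ab bc).
rewrite Rintegral_itv_obnd_cbnd; first by move=> <-; rewrite addrC subrK.
by apply: integrableS wi => //; apply: subset_itvr; rewrite bnd_simp.
Qed.

(** The quadratic upper bound at a point [z] near the mean [yb] is integrated. Its linear part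
    contributes [(b - a) * dot p (yb - z) <= 0], its quadratic part is of order [r ^ 2]. The
    inequality to be averaged is a pointwise hypothesis, so that only [zeta] and [psi] are
    integrated and never [phi \o zeta]. *)
Lemma semiconcave_jensen (d : nat) (phi : 'rV[R]_d -> R) (A K : R)
    (A_ge0 : 0 <= A) (K_gt0 : 0 < K)
    (phi_lip : forall x z, `|phi x - phi z| <= A * `|x - z|)
    (phi_sc : forall x w, phi (x + w) - 2 * phi x + phi (x - w) <= K * sqn w)
    (a b r c : R) (zeta : R -> 'rV[R]_d) (psi : R -> R) (yb : 'rV[R]_d) :
  a <= b -> 0 < r ->
  (forall i, mu.-integrable `[a, b] (EFin \o (fun s => zeta s ord0 i))) ->
  (forall i, \int[mu]_(s in `[a, b]) zeta s ord0 i = (b - a) * yb ord0 i) ->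
  (forall s, a <= s <= b -> `|zeta s - yb| <= r) ->
  mu.-integrable `[a, b] (EFin \o psi) ->
  (forall s, a <= s <= b -> c <= phi (zeta s) + psi s) ->
  (b - a) * c <= (b - a) * (phi yb + (4 * d%:R * K + A) * r ^+ 2)
                 + \int[mu]_(s in `[a, b]) psi s.
Proof.
move=> ab r0 zi zint zr psii cle.
have r20 : 0 < r ^+ 2 by rewrite exprn_gt0.
(* Distance at most [r] keeps [zeta s] within [2 * r] of [z]; distance at most [r ^ 2] makes the
   passage from [phi z] to [phi yb] cost [A * r ^ 2]. *)
have delta0 : 0 < Num.min r (r ^+ 2) by rewrite lt_min r0.
have [z [p [zy pyz phiz]]] := approx_supergradient A_ge0 K_gt0 phi_lip phi_sc yb delta0.
move: zy; rewrite le_min => /andP[zyr zyr2].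
pose C := phi z + K * (d%:R * (2 * r) ^+ 2).
have ptw s : a <= s <= b -> c <= C + (dot p (zeta s - z) + psi s).
  move=> sab; apply: (le_trans (cle _ sab)).
  have := phiz (zeta s - z); rewrite addrC subrK => h.
  have h2 : sqn (zeta s - z) <= d%:R * (2 * r) ^+ 2.
    apply: (le_trans (sqn_le_norm _)); rewrite ler_wpM2l ?ler0n// lerXn2r ?nnegrE//.
      by rewrite mulr_ge0// ltW.
    have := ler_normD (zeta s - yb) (yb - z); rewrite addrA subrK distrC => h3.
    by have := zr _ sab; rewrite distrC in zyr; lra.
  have h4 : K * sqn (zeta s - z) <= K * (d%:R * (2 * r) ^+ 2) by rewrite ler_pM2l.
  by rewrite /C; lra.
have [doti dotE] : mu.-integrable `[a, b] (EFin \o (fun s => dot p (zeta s - z))) /\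
    \int[mu]_(s in `[a, b]) dot p (zeta s - z) = (b - a) * dot p (yb - z).
  have i1 i : mu.-integrable `[a, b] (EFin \o (fun s => zeta s ord0 i - z ord0 i)).
    by apply: integrableRB => //; exact: integrable_cst_itv.
  have i2 i : mu.-integrable `[a, b]
      (EFin \o (fun s => p ord0 i * (zeta s - z) ord0 i)).
    under [X in EFin \o X]eq_fun do rewrite !mxE.
    exact: integrableRZl.
  have [h1 h2] := Rintegral_sum (index_enum 'I_d) (measurable_itv _) i2.
  split; first exact: h1.
  rewrite h2 /dot mulr_sumr; apply: eq_bigr => i _.
  under eq_Rintegral do rewrite !mxE.
  rewrite RintegralZl// RintegralB//; last exact: integrable_cst_itv.
  by rewrite Rintegral_cst_itv// zint !mxE; ring.
have i3 : mu.-integrable `[a, b] (EFin \o (fun s => dot p (zeta s - z) + psi s)).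
  exact: integrableRD.
have : \int[mu]_(s in `[a, b]) c <=
       \int[mu]_(s in `[a, b]) (C + (dot p (zeta s - z) + psi s)).
  apply: le_Rintegral => //; first exact: integrable_cst_itv.
    by apply: integrableRD => //; exact: integrable_cst_itv.
rewrite RintegralD//; last exact: integrable_cst_itv.
rewrite RintegralD// !Rintegral_cst_itv// dotE => le1.
have le2 : (b - a) * dot p (yb - z) <= 0 by rewrite mulr_ge0_le0// subr_ge0.
have le3 : C <= phi yb + (4 * d%:R * K + A) * r ^+ 2.
  have h1 := ler_norm (phi z - phi yb); have h2 := phi_lip z yb.
  have h3 : A * `|z - yb| <= A * r ^+ 2 by rewrite ler_wpM2l.
  by rewrite /C; move: (phi z) (phi yb) h1 h2 h3 => f1 f2; nra.
have le4 : C * (b - a) <= (phi yb + (4 * d%:R * K + A) * r ^+ 2) * (b - a).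
  by rewrite ler_wpM2r// subr_ge0.
by rewrite [(b - a) * c]mulrC [(b - a) * (_ + _)]mulrC; lra.
Qed.

End jensen.

(** * One-sided slope bounds for semiconcave functions of time *)

Section semiconcave_time.
Context {R : realType}.
Implicit Types (T M C : R) (psi : R -> R).

(* Consecutive decrements of psi over steps of length h differ by at most C h^2
   in the relevant direction, so that K times the first one is at most
   2 M + C (K h)^2; choose K h close to T / 2. *)
Lemma semiconcave_decrease T M C psi (t s : R) : 0 < T -> 0 <= C ->
  (forall r, 0 <= r <= T -> `|psi r| <= M) ->
  (forall r tau, 0 <= r <= T -> 0 < tau -> 0 <= r - tau <= T ->
     0 <= r + tau <= T ->
     psi (r + tau) - 2 * psi r + psi (r - tau) <= C * tau ^+ 2) ->
  0 <= t <= T / 2 -> t <= s <= T ->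
  psi t - psi s <= (8 * M / T + C * T) * (s - t).
Proof.
move=> T0 C0 bd sc /andP[t0 tT] /andP[ts sT].
have M0 : 0 <= M by apply: (le_trans (normr_ge0 (psi 0))); apply: bd; rewrite lexx ltW.
have bdl r : 0 <= r <= T -> - M <= psi r <= M by move=> /bd; rewrite ler_norml.
have MT0 : 0 <= 8 * M / T by rewrite divr_ge0 ?mulr_ge0// ltW.
have [->|st] := eqVneq s t; first by rewrite !subrr mulr0.
pose h := s - t.
have h0 : 0 < h by rewrite /h subr_gt0 lt_neqAle eq_sym st.
have -> : s = t + h by rewrite /h addrC subrK.
have -> : t + h - t = h by ring.
have hsT : t + h <= T by rewrite /h addrC subrK.
clearbody h.
have bt := bdl t ltac:(lra).
have bth := bdl (t + h) ltac:(lra).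
have MT : 8 * M / T * T = 8 * M by rewrite divfK// gt_eqF.
(* A long step needs no semiconcavity: the difference is at most [2 * M], which is
   [8 * M / T * (T / 4)]. *)
have [hT|hT] := leP (T / 4) h.
  have : 8 * M / T * (T / 4) <= 8 * M / T * h by rewrite ler_wpM2l.
  have : 0 <= C * T * h by rewrite !mulr_ge0// ltW.
  by lra.
have chain j : j.+1%:R * h <= T / 2 ->
  psi t - psi (t + h) <= psi (t + j%:R * h) - psi (t + j.+1%:R * h) + j%:R * (C * h ^+ 2).
  elim: j => [_|j IH jT]; first by rewrite mul1r !mul0r !addr0.
  have e1 : j.+1%:R = j%:R + 1 :> R by rewrite -[in LHS]addn1 natrD.
  have e2 : j.+2%:R = j%:R + 2 :> R by rewrite -[in LHS]addn2 natrD.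
  have j0 : 0 <= j%:R :> R by [].
  move: IH; rewrite e1 e2 in jT *; move: (j%:R) j0 jT => k k0 jT /(_ ltac:(lra)) IH.
  have k0h : 0 <= k * h by rewrite mulr_ge0// ltW.
  have := sc (t + (k + 1) * h) h ltac:(lra) h0 ltac:(lra) ltac:(lra).
  have -> : t + (k + 1) * h + h = t + (k + 2) * h by ring.
  have -> : t + (k + 1) * h - h = t + k * h by ring.
  by move: (psi _) (psi _) (psi _) (psi _) (psi _) IH => *; lra.
(* Summing [chain] telescopes the decrements; the errors [i * C * h ^ 2] for [i < j] add up to at
   most [j ^ 2 * C * h ^ 2]. *)
have total j : j%:R * h <= T / 2 ->
  j%:R * (psi t - psi (t + h)) <= psi t - psi (t + j%:R * h) + j%:R ^+ 2 * (C * h ^+ 2).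
  elim: j => [_|j IH jT]; first by rewrite !mul0r addr0 subrr expr0n mul0r addr0.
  have := chain _ jT.
  have e1 : j.+1%:R = j%:R + 1 :> R by rewrite -[in LHS]addn1 natrD.
  have j0 : 0 <= j%:R :> R by [].
  move: IH; rewrite e1 in jT *; move: (j%:R) j0 jT => k k0 jT /(_ ltac:(lra)) IH H.
  have Ch0 : 0 <= C * h ^+ 2 by rewrite mulr_ge0// exprn_ge0// ltW.
  move: (C * h ^+ 2) Ch0 H IH => q q0 H IH.
  by have : 0 <= k * q by [rewrite mulr_ge0|]; lra.
(* As [h < T / 4], this gives [T / 4 < K * h <= T / 2]: the steps stay in [[0, T]] because
   [t <= T / 2], and the lower bound allows the final division by [K * h]. *)
pose K := Num.truncn (T / 2 / h).
have /andP[K1 K2] : K%:R <= T / 2 / h < K.+1%:R by apply: truncn_itv; rewrite !divr_ge0// ltW.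
rewrite ler_pdivlMr// in K1; rewrite ltr_pdivrMr// in K2.
have eK : K.+1%:R = K%:R + 1 :> R by rewrite natr1.
rewrite eK in K2; clearbody K; clear eK.
have H := total _ K1.
have K0 : 0 <= K%:R * h by rewrite mulr_ge0// ltW.
have bK := bdl (t + K%:R * h) ltac:(lra).
move: (K%:R) K0 K1 K2 H bK => k K0 K1 K2 H bK.
rewrite leNgt; apply/negP => neg.
have P0 : 0 < k * h by lra.
have H1 : k * h * ((8 * M / T + C * T) * h) < k * h * (psi t - psi (t + h)).
  by rewrite ltr_pM2l.
have H2 : k * h * (psi t - psi (t + h)) <= h * (2 * M) + (k * h) ^+ 2 * (C * h).
  have : h * (k * (psi t - psi (t + h))) <= h * (2 * M + k ^+ 2 * (C * h ^+ 2)).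
    by rewrite ler_pM2l//; lra.
  by move: (psi t - psi (t + h)) => e; lra.
have H3 : h * (2 * M) <= k * h * (8 * M / T * h).
  have : 8 * M / T * (T / 4) * h <= 8 * M / T * (k * h) * h.
    by rewrite ler_wpM2r ?(ltW h0)// ler_wpM2l//; lra.
  have MTh : 8 * M / T * T * h = 8 * M * h by rewrite MT.
  by move: MTh; move: (8 * M / T) => a; lra.
have H4 : (k * h) ^+ 2 * (C * h) <= k * h * (C * T * h).
  have : k * h * (k * h) * (C * h) <= k * h * T * (C * h).
    by rewrite ler_wpM2r ?mulr_ge0 ?(ltW h0)// ler_pM2l//; lra.
  by lra.
by move: H1 H2 H3 H4; move: (8 * M / T) (psi t - psi (t + h)) (k) => a b c; lra.
Qed.

(** The time reversal [r |-> T - r] preserves the bound and the second differences and exchanges the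
    two halves of [[0, T]]. *)
Lemma semiconcave_increase T M C psi (t s : R) : 0 < T -> 0 <= C ->
  (forall r, 0 <= r <= T -> `|psi r| <= M) ->
  (forall r tau, 0 <= r <= T -> 0 < tau -> 0 <= r - tau <= T ->
     0 <= r + tau <= T ->
     psi (r + tau) - 2 * psi r + psi (r - tau) <= C * tau ^+ 2) ->
  T / 2 <= t <= T -> 0 <= s <= t ->
  psi t - psi s <= (8 * M / T + C * T) * (t - s).
Proof.
move=> T0 C0 bd sc /andP[t0 tT] /andP[ts sT].
have := @semiconcave_decrease T M C (fun r => psi (T - r)) (T - t) (T - s) T0 C0.
rewrite !subKr (_ : T - s - (T - t) = t - s); last by ring.
apply; [|move=> r tau hr tau0 hr1 hr2|lra|lra].
  by move=> r hr; apply: bd; lra.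
have := sc (T - r) tau ltac:(lra) tau0 ltac:(lra) ltac:(lra).
rewrite (_ : T - (r + tau) = T - r - tau); last by ring.
rewrite (_ : T - (r - tau) = T - r + tau); last by ring.
by lra.
Qed.

End semiconcave_time.

(** * Reduction to the sup norm and to spatial second differences *)

Section norm_comparison.
Context {R : realType} {d : nat}.
Implicit Types x z : 'rV[R]_d.

Lemma enorm_ge0 x : 0 <= enorm x.
Proof. exact: sqrtr_ge0. Qed.

Lemma norm_le_enorm x : `|x| <= enorm x.
Proof.
rewrite /enorm -[`|x|]ger0_norm// -sqrtr_sqr ler_sqrt ?sqn_ge0//.
exact: norm_le_sqn.
Qed.

Lemma enorm_le_norm x : enorm x <= d%:R * `|x|.
Proof.
rewrite /enorm -[leRHS]ger0_norm ?mulr_ge0// -sqrtr_sqr ler_sqrt ?exprn_ge0 ?mulr_ge0//.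
apply: (le_trans (sqn_le_norm x)); rewrite exprMn ler_wpM2r ?exprn_ge0//.
by rewrite -natrX ler_nat; case: (d) => // n; rewrite leq_pmulr.
Qed.

End norm_comparison.

Lemma exists_pos_below {R : realType} (s : seq R) : all (fun r => 0 < r) s ->
  exists2 t, 0 < t & all (fun r => t < r) s.
Proof.
elim: s => [_|r s IH /= /andP[r0 /IH[t t0 ts]]]; first by exists 1.
exists (Num.min (r / 2) t); first by rewrite lt_min divr_gt0.
rewrite gt_min ltr_pdivrMr// ltr_pMr// ltr1n /=.
by apply: sub_all ts => q tq; rewrite gt_min tq orbT.
Qed.

Section spatial_second_difference.
Context {R : realType} {d m : nat} (T : R) (U : set 'rV[R]_m).
Implicit Types (x z : 'rV[R]_d) (u : 'rV[R]_m).

Lemma within_continuous_time (L : 'rV[R]_d -> 'rV[R]_m -> R -> R) x u s e :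
  {within [set: 'rV[R]_d * 'rV[R]_m] `*` `[0, T],
     continuous (fun p : 'rV[R]_d * 'rV[R]_m * R => L p.1.1 p.1.2 p.2)} ->
  0 <= s <= T -> 0 < e ->
  exists2 r, 0 < r &
    forall s', 0 <= s' <= T -> `|s - s'| < r -> `|L x u s - L x u s'| < e.
Proof.
set A := _ `*` _; set F := (fun p => _) => Lc sT e0.
have Ap : A ((x, u), s) by split => //=; rewrite in_itv.
have /cvgrPdist_lt /(_ _ e0) := Lc ((x, u), s).
rewrite /prop_near1 /nbhs /= -nbhs_subspace_in// => /nbhs_ballP[r /= r0 H].
exists r => // s' s'T ss'.
have /= := H ((x, u), s'); apply; first by do 2 split => //=; exact: ballxx.
by split => //=; rewrite in_itv.
Qed.

(** Let [tau] tend to 0 in the space-time inequality, using continuity of [L] in time. The time [s]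
    is interior so that [s - tau] and [s + tau] both remain in [[0, T]]. *)
Lemma spatial_semiconcave (L : 'rV[R]_d -> 'rV[R]_m -> R -> R) (C : R) x z u s :
  0 <= C ->
  {within [set: 'rV[R]_d * 'rV[R]_m] `*` `[0, T],
     continuous (fun p : 'rV[R]_d * 'rV[R]_m * R => L p.1.1 p.1.2 p.2)} ->
  (forall tau, 0 < tau -> 0 <= s - tau <= T -> 0 <= s + tau <= T ->
     L (x + z) u (s + tau) - 2 * L x u s + L (x - z) u (s - tau)
       <= C * (enorm z ^+ 2 + tau ^+ 2)) ->
  0 < s < T ->
  L (x + z) u s - 2 * L x u s + L (x - z) u s <= C * enorm z ^+ 2.
Proof.
move=> C0 Lc H /andP[s0 sT]; apply/ler_addgt0Pr => e e0.
have e3 : 0 < e / 3 by rewrite divr_gt0.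
have [r1 r10 H1] := within_continuous_time (x + z) u Lc (s := s) ltac:(lra) e3.
have [r2 r20 H2] := within_continuous_time (x - z) u Lc (s := s) ltac:(lra) e3.
have C1 : 0 < C + 1 by lra.
have eC : 0 < e / 3 / (C + 1) by rewrite divr_gt0.
(* Below [r1] and [r2] the two values of [L] move by less than [e / 3] each; below 1 and
   [e / 3 / (C + 1)] the term [C * tau ^ 2] is at most [e / 3]. *)
have [tau t0] := @exists_pos_below R [:: r1; r2; s; T - s; 1; e / 3 / (C + 1)]
  ltac:(by rewrite /= r10 r20 s0 subr_gt0 sT ltr01 eC).
move=> /and5P[t1 t2 t3 t4 /and3P[t5 t6 _]].
have {}H1 := H1 (s + tau) ltac:(lra).
have {}H2 := H2 (s - tau) ltac:(lra).
have {}H := H tau t0 ltac:(lra) ltac:(lra).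
move: H1 H2; rewrite opprD addNKr opprB addrCA subrr addr0 normrN gtr0_norm//.
move=> /(_ t1) H1 /(_ t2) H2.
have CT : C * tau ^+ 2 <= e / 3.
  have : (C + 1) * tau <= e / 3 by rewrite mulrC -ler_pdivlMr// ltW.
  have : tau ^+ 2 <= tau by rewrite expr2 ler_piMl ?ltW.
  by move=> h1 h2; apply: le_trans h2; nra.
move: H1 H2 H; rewrite !ltr_norml; by move: (L _ _ _) => *; lra.
Qed.

(** The same limit, with the Lipschitz bound in time in place of continuity: the shift of the two
    outer values costs [2 * K * tau]. *)
Lemma spatial_second_diff (f : 'rV[R]_d -> 'rV[R]_m -> R -> 'rV[R]_d) (C K : R) x z u s :
  0 <= C -> 0 <= K ->
  (forall x' t t', 0 <= t <= T -> 0 <= t' <= T ->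
     `|f x' u t - f x' u t'| <= K * `|t - t'|) ->
  (forall tau, 0 < tau -> 0 <= s - tau <= T -> 0 <= s + tau <= T ->
     enorm (f (x + z) u (s + tau) - 2 *: f x u s + f (x - z) u (s - tau))
       <= C * (enorm z ^+ 2 + tau ^+ 2)) ->
  0 < s < T ->
  `|f (x + z) u s - 2 *: f x u s + f (x - z) u s| <= C * enorm z ^+ 2.
Proof.
move=> C0 K0 fK H /andP[s0 sT]; apply/ler_addgt0Pr => e e0.
have C1 : 0 < C + 2 * K + 1 by lra.
have eC : 0 < e / (C + 2 * K + 1) by rewrite divr_gt0.
have [tau t0] := @exists_pos_below R [:: s; T - s; 1; e / (C + 2 * K + 1)]
  ltac:(by rewrite /= s0 subr_gt0 sT ltr01 eC).
move=> /and5P[t1 t2 t3 t4 _].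
have {}H := H tau t0 ltac:(lra) ltac:(lra).
have h1 := fK (x + z) s (s + tau) ltac:(lra) ltac:(lra).
have h2 := fK (x - z) s (s - tau) ltac:(lra) ltac:(lra).
move: h1 h2; rewrite opprD addNKr opprB addrCA subrr addr0 normrN gtr0_norm// => h1 h2.
have -> : f (x + z) u s - 2 *: f x u s + f (x - z) u s =
  (f (x + z) u (s + tau) - 2 *: f x u s + f (x - z) u (s - tau)) +
  ((f (x + z) u s - f (x + z) u (s + tau)) + (f (x - z) u s - f (x - z) u (s - tau))).
  by apply/rowP => i; rewrite !mxE; ring.
apply: (le_trans (ler_normD _ _)); apply: le_trans (lerD (norm_le_enorm _) (ler_normD _ _)) _.
apply: (le_trans (lerD H (lerD h1 h2))).
have t5 : (C + 2 * K + 1) * tau <= e by rewrite mulrC -ler_pdivlMr// ltW.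
have t6 : C * tau ^+ 2 <= C * tau by rewrite ler_wpM2l// expr2 ler_piMl ?ltW.
by lra.
Qed.

End spatial_second_difference.

(** * Trajectories *)

Section solutions.
Context {R : realType} {d m : nat}.
Variables (T lambda : R) (U : set 'rV[R]_m).
Variables (f : 'rV[R]_d -> 'rV[R]_m -> R -> 'rV[R]_d).
Variables (L : 'rV[R]_d -> 'rV[R]_m -> R -> R).
Local Notation mu := (@lebesgue_measure R).

(** Discounted to time 0 and not to the initial time, so that the costs of successive windows add up
    without further factors. *)
Definition running_cost (y : R -> 'rV[R]_d) (u : R -> 'rV[R]_m) (s : R) : R :=
  expR (- (lambda * s)) * L (y s) (u s) s.

Lemma disc_shift s t :
  expR (- (lambda * s)) * expR (- (lambda * (t - s))) = expR (- (lambda * t)).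
Proof. by rewrite -expRD; congr expR; ring. Qed.

Lemma solution_increment u x t y a b i : is_solution T f u x t y ->
  t <= a -> a <= b -> b <= T ->
  \int[mu]_(r in `[a, b]) f (y r) (u r) r ord0 i = y b ord0 i - y a ord0 i.
Proof.
move=> [_ fi yE] ta ab bT.
rewrite yE ?yE ?(le_trans ta ab)//; last by rewrite ta (le_trans ab).
rewrite (@Rintegral_itv_split R t a b)//; first by ring.
by apply: integrableS (fi i) => //; apply: subset_itvl; rewrite bnd_simp.
Qed.

Lemma solution_start u x t y : is_solution T f u x t y -> t <= T -> y t = x.
Proof.
move=> [_ _ yE] tT; apply/rowP => i; have := yE t.
by rewrite lexx => /(_ tT i) ->; rewrite set_itv1 Rintegral_set1 addr0.
Qed.

(** The integrand is bounded, and measurable as a continuous function of the triple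
    [(y s, u s, s)]. *)
Lemma running_cost_integrable M u x t y :
  {within [set: 'rV[R]_d * 'rV[R]_m] `*` `[0, T],
     continuous (fun p : 'rV[R]_d * 'rV[R]_m * R => L p.1.1 p.1.2 p.2)} ->
  (forall s, t <= s <= T -> `|running_cost y u s| <= M) ->
  0 <= t -> admissible T U t u -> is_solution T f u x t y ->
  mu.-integrable `[t, T] (EFin \o running_cost y u).
Proof.
move=> Lc bd t0 [uU um] [yc _ _].
have mD : measurable `[t, T]%classic by exact: measurable_itv.
apply: measurable_bounded_integrable => //.
- by rewrite /= lebesgue_measure_itv /=; case: ifP => _; rewrite -?EFinB ltry.
- apply: measurable_funM.
    apply: measurableT_comp => //; apply: measurable_funN; exact: measurable_funM.
  have yb : measurable_base `[t, T] y.
    apply: measurable_base_rV => // i.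
    apply: subspace_continuous_measurable_fun => //.
    apply: (@within_continuous_comp _ _ _ _ y (fun v : 'rV[R]_d => v ord0 i)) => // v _.
    exact: coord_continuous.
  have ub : measurable_base `[t, T] u by exact: measurable_base_rV.
  have ib : measurable_base `[t, T] (fun s : R => s) by exact: measurable_base_R.
  have zb := measurable_base_prod (measurable_base_prod yb ub) ib.
  apply: (measurable_base_comp zb _ Lc) => s /=.
  by rewrite in_itv /= => /andP[ts sT]; split => //=; rewrite in_itv /= (le_trans t0 ts).
- exists M; split; first exact: num_real.
  move=> M' MM' s /=; rewrite in_itv /= => /bd h; apply: (le_trans h); exact: ltW.
Qed.

Lemma cost_running_cost (g : 'rV[R]_d -> R) y x t u :
  mu.-integrable `[t, T] (EFin \o running_cost (y u x t) u) ->
  expR (- (lambda * t)) * cost T lambda L g y x t u =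
  expR (- (lambda * T)) * g (y u x t T)
  + \int[mu]_(s in `[t, T]) running_cost (y u x t) u s.
Proof.
move=> ri; rewrite /cost.
have e0 : expR (- (lambda * t)) != 0 by rewrite gt_eqF// expR_gt0.
have -> : \int[mu]_(s in `[t, T]) (L (y u x t s) (u s) s * expR (- (lambda * (s - t)))) =
   (expR (- (lambda * t)))^-1 * \int[mu]_(s in `[t, T]) running_cost (y u x t) u s.
  rewrite -RintegralZl//; apply: eq_Rintegral => s _.
  by rewrite /running_cost -(disc_shift t s) -!mulrA mulKf// mulrC.
by rewrite mulrDr mulVKf// addrC mulrCA disc_shift mulrC.
Qed.

End solutions.

(** * The discrete problem along a trajectory *)

Section cost_to_go.
Context {R : realType} {d m : nat} (T lambda M : R) (U : set 'rV[R]_m).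
Variables (f : 'rV[R]_d -> 'rV[R]_m -> R -> 'rV[R]_d).
Variables (L : 'rV[R]_d -> 'rV[R]_m -> R -> R) (g : 'rV[R]_d -> R).
Variable N : nat.
Hypotheses (T_gt0 : 0 < T) (lambda_ge0 : 0 <= lambda) (M_gt0 : 0 < M).
Hypothesis (N_gt0 : (0 < N)%N).
Hypothesis L_bound : forall x u s, U u -> 0 <= s <= T -> `|L x u s| <= M.
Hypothesis g_bound : forall x, `|g x| <= M.
Hypothesis f_lip : forall x z u s, U u -> 0 <= s <= T ->
  `|f x u s - f z u s| <= M * `|x - z|.
Hypothesis L_lip : forall x z u s, U u -> 0 <= s <= T ->
  `|L x u s - L z u s| <= M * `|x - z|.
Hypothesis g_lip : forall x z, `|g x - g z| <= M * `|x - z|.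
Hypothesis f_second : forall x z u s, U u -> 0 < s < T ->
  `|f (x + z) u s - 2 *: f x u s + f (x - z) u s| <= M * `|z| ^+ 2.
Hypothesis L_sc : forall x z u s, U u -> 0 < s < T ->
  L (x + z) u s - 2 * L x u s + L (x - z) u s <= M * `|z| ^+ 2.
Hypothesis g_sc : forall x z,
  g (x + z) - 2 * g x + g (x - z) <= M * `|z| ^+ 2.

Local Notation h := (time_step T N).
Local Notation t_ := (node T N).
Local Notation disc s := (expR (- (lambda * s))).

Lemma half_sum (a b : 'rV[R]_d) : 2^-1 *: (a + b) + 2^-1 *: (a - b) = a.
Proof. by apply/rowP => i; rewrite !mxE; lra. Qed.

Lemma half_diff (a b : 'rV[R]_d) : 2^-1 *: (a + b) - 2^-1 *: (a - b) = b.
Proof. by apply/rowP => i; rewrite !mxE; lra. Qed.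

(* Cost of k steps from (x, t_n), discounted to time 0; u is indexed from the
   current step. *)
Fixpoint cost_to_go (k n : nat) (x : 'rV[R]_d) (u : nat -> 'rV[R]_m) : R :=
  if k is k'.+1 then
    h * (disc (t_ n) * L x (u 0%N) (t_ n))
    + cost_to_go k' n.+1 (x + h *: f x (u 0%N) (t_ n)) (fun j => u j.+1)
  else disc T * g x.

(** All indices are constrained, so that the set is stable under shifting a control and under
    prepending a value in [U]; [cost_to_go k] reads only the first [k] values. *)
Definition ctrl : set (nat -> 'rV[R]_m) := [set u | forall k, U (u k)].

Lemma step_gt0 : 0 < h.
Proof. by rewrite divr_gt0 ?ltr0n. Qed.

Lemma nodeN : t_ N = T.
Proof. by rewrite /node /time_step mulrCA divff ?mulr1// pnatr_eq0 -lt0n. Qed.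

Lemma nodeS n : t_ n.+1 = t_ n + h.
Proof. by rewrite /node -addn1 natrD mulrDl mul1r. Qed.

Lemma ler_node i j : (i <= j)%N -> t_ i <= t_ j.
Proof. by move=> ij; rewrite /node ler_pM2r ?step_gt0// ler_nat. Qed.

Lemma ltr_node i j : (i < j)%N -> t_ i < t_ j.
Proof. by move=> ij; rewrite /node ltr_pM2r ?step_gt0// ltr_nat. Qed.

Lemma node_ge0 i : 0 <= t_ i.
Proof. by rewrite /node mulr_ge0// ltW// step_gt0. Qed.

Lemma node_itv i : (i <= N)%N -> 0 <= t_ i <= T.
Proof. by move=> iN; rewrite node_ge0 /= -[leRHS]nodeN ler_node. Qed.

Lemma node_itvoo i : (0 < i < N)%N -> 0 < t_ i < T.
Proof.
case/andP => i0 iN; rewrite -[X in _ && (_ < X)]nodeN (ltr_node iN).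
by rewrite mulr_gt0 ?step_gt0 ?ltr0n.
Qed.

Lemma disc_ge0 s : 0 <= disc s. Proof. exact: expR_ge0. Qed.

Lemma disc_le1 s : 0 <= s -> disc s <= 1.
Proof. by move=> s0; rewrite -expR0 ler_expR oppr_le0 mulr_ge0. Qed.

Lemma disc_le_norm (s a b : R) : 0 <= s -> `|a| <= b -> `|disc s * a| <= b.
Proof.
move=> s0 ab; rewrite normrM ger0_norm ?disc_ge0//.
by apply: le_trans ab; rewrite ler_piMl// disc_le1.
Qed.

(** Only the [k] values in use are asked to lie in [U], because the bound also serves for elements
    of [discrete_admissible]. *)
Lemma cost_to_go_bound k n x u : (n + k <= N)%N ->
  (forall j, (j < k)%N -> U (u j)) ->
  `|cost_to_go k n x u| <= M * (1 + k%:R * h).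
Proof.
elim: k n x u => [|k IH] n x u nk Uu /=.
  rewrite mul0r addr0 mulr1; apply: disc_le_norm => //; exact: ltW.
apply: le_trans (ler_normD _ _) _.
have nN : (n <= N)%N by apply: leq_trans nk; exact: leq_addr.
have h1 : `|h * (disc (t_ n) * L x (u 0) (t_ n))| <= h * M.
  rewrite normrM gtr0_norm ?step_gt0// ler_pM2l ?step_gt0//.
  apply: disc_le_norm; first exact: node_ge0.
  by apply: L_bound; [exact: Uu|exact: node_itv].
have h2 := IH n.+1 (x + h *: f x (u 0) (t_ n)) (fun j => u j.+1).
rewrite addSnnS in h2; have {}h2 := h2 nk (fun j => Uu j.+1).
apply: le_trans (lerD h1 h2) _.
by rewrite -addn1 natrD; lra.
Qed.

Lemma euler_step_lip x z u s : U u -> 0 <= s <= T ->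
  `|(x + h *: f x u s) - (z + h *: f z u s)| <= (1 + h * M) * `|x - z|.
Proof.
move=> Uu sT.
have -> : (x + h *: f x u s) - (z + h *: f z u s)
    = (x - z) + h *: (f x u s - f z u s).
  by rewrite scalerBr opprD addrACA.
apply: le_trans (ler_normD _ _) _.
rewrite mulrDl mul1r lerD2l normrZ gtr0_norm ?step_gt0// -mulrA.
by rewrite ler_pM2l ?step_gt0// f_lip.
Qed.

(** The constant solves the recursion [a_0 = M], [a_(k+1) = h * M + (1 + h * M) * a_k], whose terms
    come from [L] and from the Euler step. *)
Lemma cost_to_go_lip k n x z u : (n + k <= N)%N -> ctrl u ->
  `|cost_to_go k n x u - cost_to_go k n z u|
  <= ((M + 1) * (1 + h * M) ^+ k - 1) * `|x - z|.
Proof.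
elim: k n x z u => [|k IH] n x z u nk Uu /=.
  rewrite expr0 mulr1 addrK -mulrBr.
  by apply: disc_le_norm => //; exact: ltW.
have nN : (n <= N)%N by apply: leq_trans nk; exact: leq_addr.
set x' := x + _; set z' := z + _.
set c1 := cost_to_go _ _ _ _; set c2 := cost_to_go _ _ _ _.
have -> : h * (disc (t_ n) * L x (u 0%N) (t_ n)) + c1
    - (h * (disc (t_ n) * L z (u 0%N) (t_ n)) + c2) =
    h * (disc (t_ n) * (L x (u 0%N) (t_ n) - L z (u 0%N) (t_ n))) + (c1 - c2).
  by ring.
apply: le_trans (ler_normD _ _) _.
have h1 : `|h * (disc (t_ n) * (L x (u 0%N) (t_ n) - L z (u 0%N) (t_ n)))|
    <= h * (M * `|x - z|).
  rewrite normrM gtr0_norm ?step_gt0// ler_pM2l ?step_gt0//.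
  apply: disc_le_norm; first exact: node_ge0.
  by apply: L_lip => //; exact: node_itv.
have h2 : `|c1 - c2| <= ((M + 1) * (1 + h * M) ^+ k - 1) * `|x' - z'|.
  by apply: IH => //; rewrite addSnnS.
have h3 : `|x' - z'| <= (1 + h * M) * `|x - z|.
  by apply: euler_step_lip => //; exact: node_itv.
have hM : 0 < h * M by rewrite mulr_gt0 ?step_gt0.
have h4 : 0 <= (M + 1) * (1 + h * M) ^+ k - 1.
  have : 1 <= (1 + h * M) ^+ k by rewrite exprn_ege1// lerDl ltW.
  by have := M_gt0; move: (_ ^+ k) => q; nra.
have h5 := ler_wpM2l h4 h3.
apply: le_trans (lerD h1 (le_trans h2 h5)) _.
by rewrite exprS; lra.
Qed.

Definition lip_const := (M + 1) * expR (M * T).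

(** This makes the constants uniform in the time step: [1 + h * Q <= expR (h * Q)] and
    [k * h <= T]. *)
Lemma gronwall_factor_le (Q : R) k : 0 <= Q -> (k <= N)%N -> (1 + h * Q) ^+ k <= expR (Q * T).
Proof.
move=> Q0 kN; apply: (@le_trans _ _ (expR (h * Q) ^+ k)).
  rewrite lerXn2r ?nnegrE ?expR_ge0//.
    by rewrite addr_ge0// mulr_ge0// ltW// step_gt0.
  exact: expR_ge1Dx.
rewrite -expRM_natl ler_expR mulrA mulrC ler_wpM2l//.
by rewrite -[leRHS]nodeN; exact: ler_node.
Qed.

Lemma lip_const_ge0 : 0 <= lip_const.
Proof. by rewrite mulr_ge0 ?expR_ge0// addr_ge0// ltW. Qed.

Lemma cost_to_go_unif_lip k n x z u : (n + k <= N)%N -> ctrl u ->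
  `|cost_to_go k n x u - cost_to_go k n z u| <= lip_const * `|x - z|.
Proof.
move=> nk Uu; apply: le_trans (cost_to_go_lip _ _ nk Uu) _.
rewrite ler_wpM2r// lerBlDr (@le_trans _ _ lip_const) ?lerDl//.
rewrite ler_wpM2l//; first by rewrite addr_ge0// ltW.
by apply: gronwall_factor_le; [exact: ltW|apply: leq_trans nk; exact: leq_addl].
Qed.

(** Growth rate of the semiconcavity constant per unit of time: the first two terms come from
    [(1 + h * M) ^ 2] with [h <= T], the last one from the second difference of [f], seen through
    the Lipschitz bound of the later cost. *)
Definition sc_rate := 2 * M + M ^+ 2 * T + M * lip_const.
Definition sc_const := (M + 1) * expR (sc_rate * T).

Lemma sc_rate_ge0 : 0 <= sc_rate.
Proof.
have m0 := ltW M_gt0; have t0 := ltW T_gt0.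
apply: addr_ge0; last by rewrite mulr_ge0// lip_const_ge0.
by rewrite addr_ge0 ?mulr_ge0 ?exprn_ge0.
Qed.

(** The Euler images of [x + z] and [x - z] are [c + w] and [c - w], to which the induction
    hypothesis applies. Their midpoint [c] differs from the image of [x] by half of [h] times a
    second difference of [f], hence by [O(h |z|^2)]. With [0 < n] all the nodes used are interior
    times. *)
Lemma cost_to_go_sc k n x z u : (0 < n)%N -> (n + k <= N)%N -> ctrl u ->
  cost_to_go k n (x + z) u - 2 * cost_to_go k n x u + cost_to_go k n (x - z) u
  <= ((M + 1) * (1 + h * sc_rate) ^+ k - 1) * `|z| ^+ 2.
Proof.
elim: k n x z u => [|k IH] n x z u n0 nk Uu /=.
  rewrite expr0 mulr1 addrK.
  have := g_sc x z; have := disc_le1 (ltW T_gt0); have := disc_ge0 T.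
  have : 0 <= M * `|z| ^+ 2 by rewrite mulr_ge0 ?exprn_ge0// ltW.
  move: (disc T) (g (x + z)) (g x) (g (x - z)) (M * _) => e a b c q; nra.
have nN : (n < N)%N by apply: leq_trans nk; rewrite addnS ltnS leq_addr.
have tn : 0 < t_ n < T by rewrite node_itvoo ?n0.
have tn' : 0 <= t_ n <= T by rewrite node_itv// ltnW.
set v := u 0%N; set u' := fun j => u j.+1.
pose F x := x + h *: f x v (t_ n).
rewrite -!/(F _).
pose J x := cost_to_go k n.+1 x u'.
rewrite -!/(J _).
have Uu' : ctrl u' by move=> j; exact: Uu.
have nk' : (n.+1 + k <= N)%N by rewrite addSnnS.
pose c := 2^-1 *: (F (x + z) + F (x - z)).
pose w := 2^-1 *: (F (x + z) - F (x - z)).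
have cw : c + w = F (x + z) by exact: half_sum.
have cw' : c - w = F (x - z) by exact: half_diff.
have h1 : J (F (x + z)) - 2 * J c + J (F (x - z)) <=
   ((M + 1) * (1 + h * sc_rate) ^+ k - 1) * `|w| ^+ 2.
  by rewrite -cw -cw'; exact: IH.
have h2 : `|w| <= (1 + h * M) * `|z|.
  rewrite /w normrZ gtr0_norm ?invr_gt0// ler_pdivrMl//.
  have := euler_step_lip (x + z) (x - z) (Uu 0%N) tn'.
  have -> : x + z - (x - z) = 2 *: z by apply/rowP => i; rewrite !mxE; lra.
  by rewrite normrZ gtr0_norm// mulrCA.
have h3 : `|c - F x| <= h / 2 * (M * `|z| ^+ 2).
  have -> : c - F x = (h / 2) *:
      (f (x + z) v (t_ n) - 2 *: f x v (t_ n) + f (x - z) v (t_ n)).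
    by apply/rowP => i; rewrite !mxE; lra.
  have h20 : 0 < h / 2 by rewrite divr_gt0 ?step_gt0.
  rewrite normrZ (gtr0_norm h20) (ler_pM2l h20).
  by apply: f_second => //; exact: Uu.
have h4 : `|J c - J (F x)| <= lip_const * `|c - F x|.
  exact: cost_to_go_unif_lip.
have h5 := L_sc x z (Uu 0%N) tn.
have q0 : 0 <= M * `|z| ^+ 2 by rewrite mulr_ge0 ?exprn_ge0// ltW.
have h6 : disc (t_ n) * (L (x + z) v (t_ n) - 2 * L x v (t_ n) + L (x - z) v (t_ n))
   <= M * `|z| ^+ 2.
  have := disc_le1 (node_ge0 n); have := disc_ge0 (t_ n).
  move: (disc _) h5 => e; rewrite -/v; move: (_ + _) => a; nra.
have h7 : h * (disc (t_ n) * (L (x + z) v (t_ n) - 2 * L x v (t_ n) + L (x - z) v (t_ n)))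
   <= h * (M * `|z| ^+ 2) by rewrite ler_pM2l ?step_gt0.
have h8 : J c - J (F x) <= lip_const * (h / 2 * (M * `|z| ^+ 2)).
  apply: (le_trans (ler_norm _)); apply: (le_trans h4).
  by rewrite ler_wpM2l// lip_const_ge0.
have sc0 := sc_rate_ge0.
have q1 : 1 <= (1 + h * sc_rate) ^+ k.
  by rewrite exprn_ege1// lerDl mulr_ge0// ltW// step_gt0.
have hT : h <= T by rewrite ler_pdivrMr ?ltr0n// ler_peMr ?ler1n// ltW.
have h9 : (1 + h * M) ^+ 2 <= 1 + h * (2 * M + M ^+ 2 * T).
  have : h * h * M ^+ 2 <= h * T * M ^+ 2.
    by rewrite ler_wpM2r ?exprn_ge0 ?(ltW M_gt0)// ler_pM2l ?step_gt0.
  by move: h => hh; lra.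
set B := (M + 1) * (1 + h * sc_rate) ^+ k in h1 *.
have B1 : 1 <= B by rewrite /B; have := M_gt0; move: (_ ^+ k) q1 => q; nra.
have h10 : (B - 1) * `|w| ^+ 2 <= (B - 1) * ((1 + h * (2 * M + M ^+ 2 * T)) * `|z| ^+ 2).
  rewrite ler_wpM2l ?subr_ge0//.
  apply: (@le_trans _ _ (((1 + h * M) * `|z|) ^+ 2)).
    rewrite lerXn2r ?nnegrE// mulr_ge0// addr_ge0// mulr_ge0// ltW//.
    exact: step_gt0.
  by rewrite exprMn ler_wpM2r// exprn_ge0.
(* The quantities in [h11] and [h12] are what remains when the accumulated terms are subtracted from
   the bound at [k + 1]. *)
have h11 : 0 <= (B - 1) * (h * lip_const * (M * `|z| ^+ 2)).
  by rewrite mulr_ge0 ?subr_ge0// mulr_ge0// mulr_ge0 ?lip_const_ge0// ltW// step_gt0.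
have h12 : 0 <= h * (M + M ^+ 2 * T) * `|z| ^+ 2.
  have m0 := ltW M_gt0; have t0 := ltW T_gt0.
  rewrite mulr_ge0 ?exprn_ge0// mulr_ge0 ?(ltW step_gt0)//.
  by rewrite addr_ge0 ?mulr_ge0 ?exprn_ge0.
have -> : (M + 1) * (1 + h * sc_rate) ^+ k.+1 =
    B * (1 + h * (2 * M + M ^+ 2 * T) + h * (M * lip_const)).
  by rewrite exprSr mulrA -/B /sc_rate; ring.
move: h1 h7 h8 h10 h11 h12; rewrite -/v.
move: (J _) (J _) (J _) (J _) (disc _) => j1 j2 j3 j4 e.
move: (L _ _ _) (L _ _ _) (L _ _ _) (`|w| ^+ 2) (`|z| ^+ 2) => l1 l2 l3 W P.
move: lip_const h => X hh.
by lra.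
Qed.

(** * The discrete value function at the nodes and at arbitrary initial times *)

Hypothesis U_nonempty : U !=set0.

(** This is [W_n]. The node is given by its index, so that no grid index has to be recovered from a
    real time. *)
Definition dvalue (n : nat) (x : 'rV[R]_d) : R :=
  inf [set cost_to_go (N - n) n x u | u in ctrl].

Lemma dvalue_le n x u : (n <= N)%N -> ctrl u ->
  dvalue n x <= cost_to_go (N - n) n x u.
Proof.
move=> nN Uu; apply: ge_inf; last by exists u.
exists (- (M * (1 + (N - n)%:R * h))) => _ [v Uv <-].
have := @cost_to_go_bound (N - n) n x v; rewrite subnKC//.
by move=> /(_ (leqnn N) (fun j _ => Uv j)); rewrite ler_norml => /andP[].
Qed.

Lemma le_dvalue n x c :
  (forall u, ctrl u -> c <= cost_to_go (N - n) n x u) -> c <= dvalue n x.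
Proof.
move=> H; apply: lb_le_inf => [|_ [u Uu <-]]; last exact: H.
have [v Uv] := U_nonempty.
by exists (cost_to_go (N - n) n x (fun=> v)); exists (fun=> v).
Qed.

Lemma dvalueN x : dvalue N x = disc T * g x.
Proof.
apply/eqP; rewrite eq_le; apply/andP; split.
  have [v Uv] := U_nonempty.
  by have := @dvalue_le N x (fun=> v) (leqnn N) (fun=> Uv); rewrite subnn.
by apply: le_dvalue => u _; rewrite subnn.
Qed.

Lemma dvalue_lip n x z : (n <= N)%N ->
  `|dvalue n x - dvalue n z| <= lip_const * `|x - z|.
Proof.
move=> nN.
have H x1 x2 : dvalue n x1 - lip_const * `|x1 - x2| <= dvalue n x2.
  apply: le_dvalue => u Uu.
  have h1 := @dvalue_le n x1 u nN Uu.
  have := @cost_to_go_unif_lip (N - n) n x1 x2 u; rewrite subnKC// => h2.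
  have := le_trans (ler_norm _) (h2 (leqnn N) Uu).
  by lra.
have h1 := H x z; have := H z x; rewrite distrC => h2.
by rewrite ler_norml; lra.
Qed.

Lemma sc_const_gt0 : 0 < sc_const.
Proof. by rewrite mulr_gt0 ?expR_gt0// addr_gt0. Qed.

(** Semiconcavity passes to an infimum: each control for the midpoint [x] is also a competitor at
    [x + z] and [x - z]. *)
Lemma dvalue_sc n x z : (0 < n <= N)%N ->
  dvalue n (x + z) - 2 * dvalue n x + dvalue n (x - z) <= sc_const * sqn z.
Proof.
move=> /andP[n0 nN].
suff : (dvalue n (x + z) + dvalue n (x - z) - sc_const * sqn z) / 2 <= dvalue n x by lra.
apply: le_dvalue => u Uu.
have h1 := @dvalue_le n (x + z) u nN Uu.
have h2 := @dvalue_le n (x - z) u nN Uu.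
have := @cost_to_go_sc (N - n) n x z u n0; rewrite subnKC// => /(_ (leqnn N) Uu) h3.
have h4 : ((M + 1) * (1 + h * sc_rate) ^+ (N - n) - 1) * `|z| ^+ 2 <= sc_const * sqn z.
  apply: (@le_trans _ _ (sc_const * `|z| ^+ 2)).
    rewrite ler_wpM2r ?exprn_ge0// lerBlDr (@le_trans _ _ sc_const) ?lerDl//.
    rewrite ler_wpM2l//; first by rewrite addr_ge0// ltW.
    by apply: gronwall_factor_le; [exact: sc_rate_ge0|exact: leq_subr].
  by rewrite ler_wpM2l ?norm_le_sqn// ltW// sc_const_gt0.
by lra.
Qed.

(** Prepending [v] to any control for the remaining steps gives a competitor at step [n]. *)
Lemma dvalue_step n x v : (n < N)%N -> U v ->
  dvalue n x <= h * (disc (t_ n) * L x v (t_ n)) + dvalue n.+1 (x + h *: f x v (t_ n)).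
Proof.
move=> nN Uv; rewrite -lerBlDl; apply: le_dvalue => u Uu.
rewrite lerBlDl.
pose u' j := if j is j'.+1 then u j' else v.
have := @dvalue_le n x u' (ltnW nN); rewrite -(subnSK nN) /=; apply.
by case.
Qed.

Lemma grid_itv s : 0 <= s < T ->
  [/\ t_ (grid_index T N s) <= s, s < t_ (grid_index T N s).+1 & (grid_index T N s < N)%N].
Proof.
move=> /andP[s0 sT].
have sh : 0 <= s / h by rewrite divr_ge0// ltW// step_gt0.
have /andP[h1 h2] := truncn_itv sh.
have g1 : t_ (grid_index T N s) <= s by rewrite /node -ler_pdivlMr ?step_gt0.
split=> //; first by rewrite /node -ltr_pdivrMr ?step_gt0.
rewrite ltnNge; apply/negP => /ler_node; rewrite nodeN => h3.
by have := le_lt_trans (le_trans h3 g1) sT; rewrite ltxx.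
Qed.

(** After its first, possibly shorter, step the Euler scheme advances by full steps, so that the
    tail of [discrete_cost] obeys the recursion of [cost_to_go]. *)
Lemma cost_to_go_euler x s u k i : (grid_index T N s < i)%N -> (i + k = N)%N ->
  cost_to_go k i (euler T f N x s u i) (fun j => u (i + j)%N) =
  h * (\sum_(i <= j < N) disc (t_ j) * L (euler T f N x s u j) (u j) (t_ j))
  + disc T * g (euler T f N x s u N).
Proof.
elim: k i => [|k IH] i gi iN.
  by move: iN; rewrite addn0 => ->; rewrite big_geq// mulr0 add0r.
have iN' : (i < N)%N by rewrite -iN addnS ltnS leq_addr.
rewrite big_ltn//= addn0 mulrDr -addrA; congr (_ + _).
rewrite -IH ?addSnnS//; last exact: ltnW.
rewrite /= leqNgt gi /=; congr cost_to_go.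
by apply/funext => j; rewrite addSnnS.
Qed.

Lemma discrete_cost_cost_to_go x s u : 0 <= s < T ->
  disc s * discrete_cost T lambda f L g N x s u =
  (t_ (grid_index T N s).+1 - s) * (disc s * L x (u (grid_index T N s)) s) +
  cost_to_go (N - (grid_index T N s).+1) (grid_index T N s).+1
   (x + (t_ (grid_index T N s).+1 - s) *: f x (u (grid_index T N s)) s)
   (fun j => u ((grid_index T N s).+1 + j)%N).
Proof.
move=> sT; have [_ _ nN] := grid_itv sT.
have -> : x + (t_ (grid_index T N s).+1 - s) *: f x (u (grid_index T N s)) s =
    euler T f N x s u (grid_index T N s).+1 by rewrite /= leqnn.
rewrite cost_to_go_euler ?subnKC// /discrete_cost.
set n := grid_index T N s.
rewrite 2!mulrDr -addrA; congr (_ + (_ + _)); first by ring.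
  rewrite mulrCA; congr (_ * _); rewrite mulr_sumr; apply: eq_bigr => j _.
  by rewrite mulrCA disc_shift mulrC.
by rewrite mulrCA disc_shift mulrC.
Qed.

(** Deals with initial times off the grid: [v] is used up to the next node, where the running cost
    is at most [h * M], and an arbitrary control from there on. *)
Lemma discrete_value_le x s v : 0 <= s < T -> U v ->
  disc s * discrete_value T lambda U f L g N x s <=
  h * M + dvalue (grid_index T N s).+1
    (x + (t_ (grid_index T N s).+1 - s) *: f x v s).
Proof.
move=> sT Uv; have [g1 g2 nN] := grid_itv sT.
have /andP[s0 sT'] := sT.
set n := grid_index T N s in g1 g2 nN *.
have ds0 : 0 < disc s by exact: expR_gt0.
rewrite -lerBlDl; apply: le_dvalue => u Uu; rewrite lerBlDl.
pose u' j := if (j <= n)%N then v else u (j - n.+1)%N.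
have Uu' j : U (u' j) by rewrite /u'; case: ifP.
have t1 : 0 <= t_ n.+1 - s by rewrite subr_ge0 ltW.
have first_bd w : U w -> `|(t_ n.+1 - s) * (disc s * L x w s)| <= h * M.
  move=> Uw; rewrite normrM ger0_norm//.
  apply: ler_pM => //; first by move: g1; rewrite nodeS; lra.
  by apply: disc_le_norm => //; apply: L_bound => //; rewrite s0 ltW.
have le1 : discrete_value T lambda U f L g N x s <= discrete_cost T lambda f L g N x s u'.
  rewrite /discrete_value sT'; apply: ge_inf; last by exists u' => // k _.
  (* A lower bound for all costs, as required to compare a real infimum with one of them; the
     division by [disc s] undoes the discount to time 0. *)
  exists (- ((h * M + M * (1 + (N - n.+1)%:R * h)) / disc s)) => _ [w Uw <-].
  rewrite lerNl ler_pdivlMr//.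
  have := discrete_cost_cost_to_go x w sT; rewrite -/n mulrC => Ew.
  rewrite mulNr Ew.
  have h1 := first_bd _ (Uw n ltac:(by rewrite leqnn nN)).
  have h2 : `|cost_to_go (N - n.+1) n.+1 (x + (t_ n.+1 - s) *: f x (w n) s)
      (fun j => w (n.+1 + j)%N)| <= M * (1 + (N - n.+1)%:R * h).
    apply: cost_to_go_bound => [|j jN]; first by rewrite subnKC.
    apply: Uw; rewrite -/n -ltn_subRL jN andbT.
    by rewrite addSn ltnW// ltnS leq_addr.
  by move: h1 h2; rewrite !ler_norml => /andP[? ?] /andP[? ?]; lra.
apply: le_trans (ler_wpM2l (ltW ds0) le1) _.
rewrite discrete_cost_cost_to_go// -/n /u' leqnn.
apply: lerD.
  by apply: (le_trans (ler_norm _)); exact: first_bd.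
rewrite (_ : (fun j => _) = u)//; apply/funext => j.
by rewrite leqNgt addSn ltnS leq_addr /= subSS addKn.
Qed.

(** * Comparison of the discrete value with the cost of one trajectory *)

Hypothesis f_bound : forall x u s, U u -> 0 <= s <= T -> `|f x u s| <= M.
Hypothesis f_lip_time : forall x z u s t, U u -> 0 <= s <= T -> 0 <= t <= T ->
  `|f x u s - f z u t| <= M * (`|x - z| + `|s - t|).
Hypothesis L_decrease : forall x u t s, U u -> 0 <= t <= T / 2 -> t <= s <= T ->
  L x u t - L x u s <= M * (s - t).
Hypothesis L_increase : forall x u t s, U u -> T / 2 <= t <= T -> 0 <= s <= t ->
  L x u t - L x u s <= M * (t - s).

Local Notation mu := (@lebesgue_measure R).

Lemma disc_lip (a b : R) : 0 <= a -> 0 <= b -> `|disc a - disc b| <= lambda * `|a - b|.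
Proof.
wlog ab : a b / a <= b.
  move=> H a0 b0; have [ab|ba] := leP a b; first exact: H.
  by rewrite distrC (distrC a); apply: H => //; exact: ltW.
move=> a0 b0; rewrite (distrC a b) (ger0_norm (_ : 0 <= b - a)) ?subr_ge0//.
rewrite ger0_norm; last by rewrite subr_ge0 ler_expR lerN2 ler_wpM2l.
rewrite -(disc_shift lambda a b) -{1}[disc a]mulr1 -mulrBr.
have e1 := expR_ge1Dx (- (lambda * (b - a))).
have e2 : expR (- (lambda * (b - a))) <= 1.
  by rewrite expR_le1 oppr_le0 mulr_ge0// subr_ge0.
apply: le_trans (_ : 1 - expR (- (lambda * (b - a))) <= _); last by lra.
by rewrite ler_piMl ?subr_ge0// disc_le1.
Qed.

Section trajectory.
Variables (t0 : R) (y : R -> 'rV[R]_d) (u : R -> 'rV[R]_m).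
Hypothesis t0_itv : 0 <= t0 <= T.
Hypothesis Uu : forall s, t0 <= s <= T -> U (u s).
Hypothesis f_int : forall i, mu.-integrable `[t0, T]
  (EFin \o (fun r => f (y r) (u r) r ord0 i)).
Hypothesis y_eq : forall a b, t0 <= a -> a <= b -> b <= T -> forall i,
  \int[mu]_(r in `[a, b]) f (y r) (u r) r ord0 i = y b ord0 i - y a ord0 i.

Local Notation running_cost := (running_cost lambda L y u).
Hypothesis L_int : mu.-integrable `[t0, T] (EFin \o running_cost).

Lemma sub_itv (a b s : R) : t0 <= a -> b <= T -> a <= s <= b ->
  [/\ t0 <= s <= T, 0 <= s & 0 <= s <= T].
Proof.
move=> a0 bT /andP[as_ sb]; have /andP[? ?] := t0_itv.
by split; lra.
Qed.

Lemma integrable_sub (a b : R) (w : R -> R) : t0 <= a -> b <= T ->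
  mu.-integrable `[t0, T] (EFin \o w) -> mu.-integrable `[a, b] (EFin \o w).
Proof.
move=> a0 bT; apply: integrableS => //.
by apply: subset_itv; rewrite bnd_simp.
Qed.

Lemma trajectory_lip (a b : R) : t0 <= a -> a <= b -> b <= T ->
  `|y b - y a| <= M * (b - a).
Proof.
move=> a0 ab bT; apply: norm_leP => [|i].
  by rewrite mulr_ge0 ?subr_ge0// ltW.
rewrite !mxE -y_eq//.
have fi := integrable_sub a0 bT (f_int i).
have fb s : a <= s <= b -> `|f (y s) (u s) s ord0 i| <= M.
  move=> /(sub_itv a0 bT)[s1 _ s2].
  by apply: le_trans (coord_le_norm _ _) _; apply: f_bound => //; exact: Uu.
have ci c := integrable_cst_itv a b c.
rewrite ler_norml; apply/andP; split.
  rewrite -mulNr -Rintegral_cst_itv//; apply: le_Rintegral => // s /=.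
  by rewrite in_itv /= => /fb; rewrite ler_norml => /andP[].
rewrite -Rintegral_cst_itv//; apply: le_Rintegral => // s /=.
by rewrite in_itv /= => /fb; rewrite ler_norml => /andP[].
Qed.

Lemma running_cost_bound s : t0 <= s <= T -> `|running_cost s| <= M.
Proof.
move=> sT; have [_ s0 sT'] := sub_itv (lexx t0) (lexx T) sT.
by apply: disc_le_norm => //; apply: L_bound => //; exact: Uu.
Qed.

(** Error, in units of [h ^ 2], of replacing [(y a, t_n)] by [(y s, s)]: in the Euler image, in [L]
    through space and then time, and in the discount factor. The other summand of [window_const] is
    the Jensen error for [r = 2 * h * M]. *)
Definition window_error := lip_const * (M * (M + 2)) + M ^+ 2 + M + 2 * lambda * M.
Definition window_const :=
  (4 * d%:R * sc_const + lip_const) * (4 * M ^+ 2) + window_error.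

(** The node [t_n] may be either end of the window; the one-sided bound on [L] in time is left as a
    hypothesis, since its source depends on the end. *)
Lemma window_step n a : (0 < n < N)%N -> t0 <= a -> a + h <= T ->
  t_ n - h <= a <= t_ n ->
  (forall x v s, U v -> a <= s <= a + h -> L x v (t_ n) - L x v s <= M * h) ->
  dvalue n (y a) <= dvalue n.+1 (y (a + h))
    + \int[mu]_(s in `[a, a + h]) running_cost s + window_const * h ^+ 2.
Proof.
move=> /andP[n0 nN] a0 ahT an Ltime.
have h0 := step_gt0; have m0 := ltW M_gt0.
have aah : a <= a + h by rewrite lerDl ltW.
have tn : 0 <= t_ n <= T by rewrite node_itv// ltnW.
have X0 := lip_const_ge0.
(* By the integral equation the mean of [zeta] over the window is exactly [y (a + h)]. *)
pose zeta s := y a + h *: f (y s) (u s) s.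
pose psi s := h * running_cost s + window_error * h ^+ 2.
have ii := integrable_sub a0 ahT.
have zeta_int i : mu.-integrable `[a, a + h] (EFin \o (fun s => zeta s ord0 i)).
  under [X in EFin \o X]eq_fun do rewrite !mxE.
  apply: integrableRD; first exact: integrable_cst_itv.
  by apply: integrableRZl; exact: ii.
have zetaE i : \int[mu]_(s in `[a, a + h]) zeta s ord0 i
    = (a + h - a) * y (a + h) ord0 i.
  under eq_Rintegral do rewrite !mxE.
  rewrite RintegralD//; [|exact: integrable_cst_itv|by apply: integrableRZl; exact: ii].
  rewrite RintegralZl//; last exact: ii.
  by rewrite Rintegral_cst_itv// y_eq//; ring.
have in_ahT s : a <= s <= a + h -> [/\ t0 <= s <= T, 0 <= s & 0 <= s <= T].
  exact: sub_itv.
have zetar s : a <= s <= a + h -> `|zeta s - y (a + h)| <= 2 * h * M.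
  move=> /in_ahT[s1 _ s2].
  have -> : zeta s - y (a + h) = h *: f (y s) (u s) s - (y (a + h) - y a).
    by apply/rowP => i; rewrite !mxE; ring.
  apply: le_trans (ler_normB _ _) _.
  have h1 : `|h *: f (y s) (u s) s| <= h * M.
    by rewrite normrZ gtr0_norm// ler_pM2l// f_bound//; exact: Uu.
  have := trajectory_lip a0 aah ahT.
  by lra.
have psi_int : mu.-integrable `[a, a + h] (EFin \o psi).
  apply: integrableRD; last exact: integrable_cst_itv.
  by apply: integrableRZl; exact: ii.
have ptw s : a <= s <= a + h -> dvalue n (y a) <= dvalue n.+1 (zeta s) + psi s.
  move=> sah; have [s1 s0 s2] := in_ahT _ sah.
  have Us := Uu s1; have /andP[as_ sh] := sah.
  have h1 := dvalue_step (y a) nN Us.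
  have yas : `|y a - y s| <= M * h.
    rewrite distrC; apply: le_trans (trajectory_lip a0 as_ _) _; first lra.
    by rewrite ler_wpM2l//; lra.
  have tns : `|t_ n - s| <= 2 * h by rewrite ler_norml; lra.
  have h2 : dvalue n.+1 (y a + h *: f (y a) (u s) (t_ n)) - dvalue n.+1 (zeta s)
      <= lip_const * (h * (M * (M * h + 2 * h))).
    apply: (le_trans (ler_norm _)); apply: (le_trans (dvalue_lip _ _ nN)).
    rewrite ler_wpM2l//.
    have -> : y a + h *: f (y a) (u s) (t_ n) - zeta s =
      h *: (f (y a) (u s) (t_ n) - f (y s) (u s) s).
      by apply/rowP => i; rewrite !mxE; ring.
    rewrite normrZ gtr0_norm// ler_pM2l//.
    apply: le_trans (f_lip_time _ _ Us tn s2) _.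
    by rewrite ler_wpM2l//; lra.
  (* The state is changed at time [t_n] by the Lipschitz bound, then the time by [Ltime]; an upper
     bound is all that is needed. *)
  have h3 : L (y a) (u s) (t_ n) - L (y s) (u s) s <= M * (M * h) + M * h.
    have := le_trans (ler_norm _) (L_lip (y a) (y s) Us tn).
    have : M * `|y a - y s| <= M * (M * h) by rewrite ler_wpM2l.
    have := Ltime (y s) (u s) s Us sah.
    by lra.
  have h4 : disc (t_ n) * (L (y a) (u s) (t_ n) - L (y s) (u s) s)
      <= M * (M * h) + M * h.
    have p0 : 0 <= M * (M * h) + M * h by rewrite addr_ge0 ?mulr_ge0// ltW.
    apply: (le_trans (ler_wpM2l (disc_ge0 _) h3)).
    by rewrite ler_piMl// disc_le1// node_ge0.
  have h5 : (disc (t_ n) - disc s) * L (y s) (u s) s <= lambda * (2 * h) * M.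
    apply: (le_trans (ler_norm _)); rewrite normrM ler_pM ?L_bound//.
    apply: le_trans (disc_lip (node_ge0 n) s0) _.
    by rewrite ler_wpM2l.
  have h6 : disc (t_ n) * L (y a) (u s) (t_ n) <=
      running_cost s + (M * (M * h) + M * h + lambda * (2 * h) * M).
    by move: h4 h5; rewrite /running_cost; lra.
  have h7 : h * (disc (t_ n) * L (y a) (u s) (t_ n)) <=
      h * (running_cost s + (M * (M * h) + M * h + lambda * (2 * h) * M)).
    by rewrite ler_pM2l.
  rewrite /psi /window_error; move: h1 h2 h7.
  move: (dvalue _ _) (dvalue _ _) (dvalue _ _) => v1 v2 v3.
  move: (disc _ * _) (running_cost s) => l1 l2.
  by move: h lip_const => hh X; lra.
have r0 : 0 < 2 * h * M.
  apply: mulr_gt0; last exact: M_gt0.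
  by apply: mulr_gt0; [rewrite ltr0n|exact: h0].
have := semiconcave_jensen lip_const_ge0 sc_const_gt0 (fun x z => dvalue_lip x z nN)
  (fun x w => @dvalue_sc n.+1 x w nN) aah r0 zeta_int zetaE zetar psi_int ptw.
rewrite /psi RintegralD//; [|by apply: integrableRZl; exact: ii|exact: integrable_cst_itv].
rewrite RintegralZl//; last exact: ii.
rewrite Rintegral_cst_itv// (_ : a + h - a = h); last by ring.
(* Both sides of Jensen's inequality carry the window length [h] as a factor, which is cancelled
   here. *)
move=> H; rewrite -(ler_pM2l h0).
apply: (le_trans H); rewrite /window_const.
move: (dvalue _ _) (Rintegral _ _ _) => v1 v2.
by move: h lip_const sc_const window_error => hh X S E; lra.
Qed.

Lemma running_cost_int_ge a b : t0 <= a -> a <= b -> b <= T ->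
  - (M * (b - a)) <= \int[mu]_(s in `[a, b]) running_cost s.
Proof.
move=> a0 ab bT; rewrite -mulNr -Rintegral_cst_itv//; apply: le_Rintegral => //.
- exact: integrable_cst_itv.
- exact: integrable_sub.
move=> s /=; rewrite in_itv /= => /(sub_itv a0 bT)[/running_cost_bound s1 _ _].
by move: s1; rewrite ler_norml => /andP[].
Qed.

Lemma window_const_ge0 : 0 <= window_const.
Proof.
have m0 := ltW M_gt0; have l0 := lip_const_ge0; have s0 := ltW sc_const_gt0.
have e0 : 0 <= window_error by rewrite /window_error !addr_ge0 ?mulr_ge0 ?addr_ge0 ?exprn_ge0.
apply: addr_ge0 => //; apply: mulr_ge0; last by apply: mulr_ge0 => //; exact: exprn_ge0.
by apply: addr_ge0 => //; apply: mulr_ge0 => //; exact: mulr_ge0.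
Qed.

(* Here the discrete problem is one step ahead of the trajectory. *)
Lemma late_windows j k : t0 <= t_ k -> (k.+1 + j)%N = N -> T / 2 <= t_ k.+1 ->
  dvalue k.+1 (y (t_ k)) <= disc T * g (y T) + \int[mu]_(s in `[t_ k, T]) running_cost s
    + window_const * h ^+ 2 * j%:R + (M ^+ 2 + M) * h.
Proof.
have m0 := ltW M_gt0; have h0 := step_gt0.
elim: j k => [|j IH] k tk kN tkT.
  rewrite addn0 in kN.
  have tkh : t_ k + h = T by rewrite -nodeS kN nodeN.
  rewrite kN dvalueN mulr0 addr0.
  (* At the end the lag leaves one window of the trajectory unmatched: the final cost changes by at
     most [M ^ 2 * h], and the running cost left over is at least [- M * h]. *)
  have h1 : disc T * g (y (t_ k)) - disc T * g (y T) <= M ^+ 2 * h.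
    rewrite -mulrBr; apply: (le_trans (ler_norm _)).
    apply: disc_le_norm; first exact: ltW.
    apply: (le_trans (g_lip _ _)); rewrite distrC expr2 -mulrA ler_wpM2l//.
    apply: (le_trans (trajectory_lip tk _ _)); [lra|by []|].
    by rewrite ler_wpM2l//; lra.
  have h2 := @running_cost_int_ge (t_ k) T tk ltac:(lra) (lexx T).
  have h3 : M * (T - t_ k) = M * h by congr (_ * _); lra.
  by rewrite h3 in h2; lra.
have tkT' : t_ k + h <= T by rewrite -nodeS -[leRHS]nodeN ler_node// -kN leq_addr.
have kN' : (k.+1 < N)%N by rewrite -kN addnS ltnS leq_addr.
have tk1 : t0 <= t_ k.+1 by rewrite nodeS; lra.
have tk1T : t_ k.+1 <= T by rewrite nodeS.
have tk2 : T / 2 <= t_ k.+2 by apply: (le_trans tkT); exact: ler_node.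
have h1 := IH k.+1 tk1 ltac:(by rewrite addSnnS) tk2.
(* The node is the right end of the window and lies in the second half of [[0, T]], so that
   [L_increase] covers the earlier times [s]. *)
have h2 : dvalue k.+1 (y (t_ k)) <= dvalue k.+2 (y (t_ k + h))
    + \int[mu]_(s in `[t_ k, t_ k + h]) running_cost s + window_const * h ^+ 2.
  apply: window_step => //; first by rewrite nodeS; lra.
  move=> x v s Uv /andP[s1 s2].
  have tk0 := node_ge0 k.
  have := L_increase x (t := t_ k.+1) (s := s) Uv.
  rewrite tkT tk1T => /(_ isT); rewrite nodeS => /(_ ltac:(lra)) h3.
  apply: (le_trans h3); rewrite ler_wpM2l//; lra.
rewrite -nodeS in h2.
have h3 := @Rintegral_itv_split R (t_ k) (t_ k.+1) T running_cost
  ltac:(rewrite nodeS; lra) tk1T (integrable_sub tk (lexx T) L_int).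
rewrite h3 -natr1; move: h1 h2.
move: (dvalue _ _) (dvalue _ _) (Rintegral _ _ _) (Rintegral _ _ _) (disc T * _).
by move: window_const h => W hh; move=> *; lra.
Qed.

(** [M ^ 2 + M] is the price of the lag at the final time, [M + lip_const * M] that of creating the
    lag. *)
Definition tail_const := M ^+ 2 + M + M + lip_const * M.

Lemma remaining_windows j k : t0 <= t_ k -> (0 < k)%N -> (k + j)%N = N ->
  dvalue k (y (t_ k)) <= disc T * g (y T) + \int[mu]_(s in `[t_ k, T]) running_cost s
    + window_const * h ^+ 2 * j%:R + tail_const * h.
Proof.
have m0 := ltW M_gt0; have h0 := step_gt0; have X0 := lip_const_ge0.
have w0 := window_const_ge0.
have tail0 : 0 <= tail_const * h.
  apply: mulr_ge0; last exact: ltW.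
  by rewrite /tail_const; apply: addr_ge0; [rewrite !addr_ge0 ?exprn_ge0|exact: mulr_ge0].
elim: j k => [|j IH] k tk k0 kN.
  rewrite addn0 in kN; rewrite kN dvalueN nodeN mulr0 addr0.
  have /andP[_ t0T] := t0_itv.
  have := running_cost_int_ge t0T (lexx T) (lexx T).
  rewrite subrr mulr0 oppr0 => i0.
  by move: (disc T * _) => q; lra.
have kN' : (k < N)%N by rewrite -kN addnS ltnS leq_addr.
have tkT' : t_ k + h <= T by rewrite -nodeS -[leRHS]nodeN ler_node.
have tk1 : t0 <= t_ k.+1 by rewrite nodeS; lra.
have tk1T : t_ k.+1 <= T by rewrite nodeS.
(* Past [T / 2] the discrete problem takes one step while the trajectory stands still: this costs at
   most [h * M], and the state is off by at most [h * M]. From there on [late_windows] applies. *)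
have [tkT|tkT] := leP (t_ k) (T / 2); last first.
  have h1 := @late_windows j k tk ltac:(by rewrite addSnnS)
    ltac:(by rewrite nodeS; lra).
  have tkT2 : t0 <= t_ k <= T by rewrite tk/=; lra.
  have [_ tk0 tkT3] := sub_itv (lexx t0) (lexx T) tkT2.
  have h2 := dvalue_step (y (t_ k)) kN' (Uu tkT2).
  have h3 : dvalue k.+1 (y (t_ k) + h *: f (y (t_ k)) (u (t_ k)) (t_ k))
      - dvalue k.+1 (y (t_ k)) <= lip_const * (h * M).
    apply: (le_trans (ler_norm _)); apply: (le_trans (dvalue_lip _ _ kN')).
    rewrite ler_wpM2l// addrAC subrr add0r normrZ gtr0_norm// ler_pM2l//.
    by apply: f_bound => //; exact: Uu.
  have h4 : h * (disc (t_ k) * L (y (t_ k)) (u (t_ k)) (t_ k)) <= h * M.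
    by rewrite ler_pM2l//; apply: (le_trans (ler_norm _)); exact: running_cost_bound.
  have h5 : 0 <= window_const * h ^+ 2 by rewrite mulr_ge0// exprn_ge0// ltW.
  rewrite /tail_const -natr1; move: h1 h2 h3 h4.
  move: (dvalue _ _) (dvalue _ _) (dvalue _ _) (Rintegral _ _ _) (disc T * _).
  move: (h * (disc _ * _)); move: window_const h lip_const h5 => W hh X h5.
  by move=> *; lra.
have h1 := IH k.+1 tk1 isT ltac:(by rewrite addSnnS).
have h2 : dvalue k (y (t_ k)) <= dvalue k.+1 (y (t_ k + h))
    + \int[mu]_(s in `[t_ k, t_ k + h]) running_cost s + window_const * h ^+ 2.
  apply: window_step => //; [by rewrite k0|by lra|].
  move=> x v s Uv /andP[s1 s2].
  have tk0 := node_ge0 k.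
  have := L_decrease x (t := t_ k) (s := s) Uv.
  rewrite tk0 tkT s1 => /(_ isT) /(_ ltac:(lra)) h3.
  apply: (le_trans h3); rewrite ler_wpM2l//; lra.
rewrite -nodeS in h2.
have h3 := @Rintegral_itv_split R (t_ k) (t_ k.+1) T running_cost
  ltac:(rewrite nodeS; lra) tk1T (integrable_sub tk (lexx T) L_int).
rewrite h3 -natr1; move: h1 h2.
move: (dvalue _ _) (dvalue _ _) (Rintegral _ _ _) (Rintegral _ _ _) (disc T * _).
by move: window_const h (tail_const * h) => W hh X; move=> *; lra.
Qed.

(** The first two terms pay for the partial step before the first node: running costs of both
    problems, and distance between the Euler point and the trajectory. At most [T / h] windows
    contribute [window_const * h ^ 2] each. *)
Definition total_const := 2 * M + 2 * (lip_const * M) + window_const * T + tail_const.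

Lemma trajectory_bound : t0 < T ->
  disc t0 * discrete_value T lambda U f L g N (y t0) t0 <=
  disc T * g (y T) + \int[mu]_(s in `[t0, T]) running_cost s + total_const * h.
Proof.
move=> t0T; have m0 := ltW M_gt0; have h0 := step_gt0; have X0 := lip_const_ge0.
have /andP[t00 _] := t0_itv.
have t0T' : 0 <= t0 < T by rewrite t00.
have [g1 g2 nN] := grid_itv t0T'.
have t0t0 : t0 <= t0 <= T by rewrite lexx ltW.
have h1 := discrete_value_le (y t0) t0T' (Uu t0t0).
set n := grid_index T N t0 in g1 g2 nN h1.
have tnT : t_ n.+1 <= T by rewrite -[leRHS]nodeN ler_node.
have tn0 : t_ n.+1 - t0 <= h by rewrite nodeS; lra.
have tn1 : 0 <= t_ n.+1 - t0 by lra.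
have h2 := @remaining_windows (N - n.+1) n.+1 (ltW g2) isT (subnKC nN).
have h3 : dvalue n.+1 (y t0 + (t_ n.+1 - t0) *: f (y t0) (u t0) t0)
    - dvalue n.+1 (y (t_ n.+1)) <= lip_const * (2 * (M * h)).
  apply: (le_trans (ler_norm _)); apply: (le_trans (dvalue_lip _ _ nN)).
  rewrite ler_wpM2l//.
  have -> : y t0 + (t_ n.+1 - t0) *: f (y t0) (u t0) t0 - y (t_ n.+1) =
     (t_ n.+1 - t0) *: f (y t0) (u t0) t0 - (y (t_ n.+1) - y t0).
    by apply/rowP => i; rewrite !mxE; ring.
  apply: (le_trans (ler_normB _ _)).
  have := trajectory_lip (lexx t0) (ltW g2) tnT.
  have : M * (t_ n.+1 - t0) <= M * h by rewrite ler_wpM2l.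
  have : `|(t_ n.+1 - t0) *: f (y t0) (u t0) t0| <= h * M.
    rewrite normrZ ger0_norm//; apply: ler_pM => //.
    by apply: f_bound; [exact: Uu|rewrite t00 ltW].
  by lra.
have h4 := @Rintegral_itv_split R t0 (t_ n.+1) T running_cost (ltW g2) tnT L_int.
have h5 := running_cost_int_ge (lexx t0) (ltW g2) tnT.
have h6 : M * (t_ n.+1 - t0) <= M * h by rewrite ler_wpM2l.
have h7 : window_const * h ^+ 2 * (N - n.+1)%:R <= window_const * T * h.
  have : h * (N - n.+1)%:R <= T.
    rewrite mulrC -[leRHS]nodeN; apply: ler_node; exact: leq_subr.
  have w0 : 0 <= window_const * h by rewrite mulr_ge0 ?window_const_ge0// ltW.
  by move=> /(ler_wpM2l w0); lra.
rewrite h4 /total_const; move: h1 h2 h3 h5 h6 h7.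
move: (dvalue _ _) (dvalue _ _) (Rintegral _ _ _) (Rintegral _ _ _) (disc T * _) (disc t0 * _).
move: (window_const * h ^+ 2 * _) => q.
by move: window_const h tail_const lip_const => W hh X Y; move=> *; lra.
Qed.

End trajectory.

Lemma total_const_ge0 : 0 <= total_const.
Proof.
have m0 := ltW M_gt0; have X0 := lip_const_ge0; have Xm : 0 <= lip_const * M by exact: mulr_ge0.
have wT : 0 <= window_const * T by rewrite mulr_ge0 ?window_const_ge0// ltW.
have M2 : 0 <= M ^+ 2 by exact: exprn_ge0.
by rewrite /total_const /tail_const; lra.
Qed.

Lemma discrete_value_le_cost y x t u :
  {within [set: 'rV[R]_d * 'rV[R]_m] `*` `[0, T],
     continuous (fun p : 'rV[R]_d * 'rV[R]_m * R => L p.1.1 p.1.2 p.2)} ->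
  is_solution_map T U f y -> 0 <= t <= T -> admissible T U t u ->
  discrete_value T lambda U f L g N x t <=
  cost T lambda L g y x t u + total_const * expR (lambda * T) * h.
Proof.
move=> L_cont y_sol tT u_adm; have /andP[t0 tT'] := tT.
have h0 := step_gt0; have C0 := total_const_ge0.
have [ysol _] := y_sol t x u tT u_adm.
have [uU _] := u_adm.
have ystart := solution_start ysol tT'.
have Lint : mu.-integrable `[t, T] (EFin \o running_cost lambda L (y u x t) u).
  apply: (running_cost_integrable (M := M) L_cont _ t0 u_adm ysol).
  exact: running_cost_bound.
have et : 0 < disc t by exact: expR_gt0.
rewrite -(ler_pM2l et) mulrDr cost_running_cost//.
(* Undoing the discount to time 0 multiplies the error by [expR (lambda * t)], at most
   [expR (lambda * T)]. *)
have err : total_const * h <= disc t * (total_const * expR (lambda * T) * h).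
  have -> : disc t * (total_const * expR (lambda * T) * h) =
      total_const * h * expR (lambda * (T - t)).
    by rewrite mulrBr expRD; ring.
  rewrite -[leLHS]mulr1 ler_wpM2l//; first exact: mulr_ge0 C0 (ltW h0).
  by rewrite -[leLHS]expR0 ler_expR mulr_ge0// subr_ge0.
have [tltT|Tt] := ltP t T; last first.
  have tE : t = T by apply/eqP; rewrite eq_le tT' Tt.
  have -> : discrete_value T lambda U f L g N x t = g x by rewrite /discrete_value tE ltxx.
  have -> : \int[mu]_(s in `[t, T]) running_cost lambda L (y u x t) u s = 0.
    by rewrite tE set_itv1 Rintegral_set1.
  have -> : y u x t T = x by rewrite -{1}tE in ystart *.
  have -> : disc T = disc t by rewrite tE.
  by rewrite addr0 lerDl; apply: le_trans err; rewrite mulr_ge0// ltW.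
have [_ fi _] := ysol.
have H := trajectory_bound tT uU fi
  (fun a b ta ab bT i => solution_increment i ysol ta ab bT) Lint tltT.
rewrite ystart in H; apply: (le_trans H).
by rewrite lerD2l.
Qed.

End cost_to_go.

(** * Error estimate *)

(** Converts a bound by a Euclidean quantity [p], with a constant [c] of unknown sign, into one by a
    max-norm quantity [q] with the common constant [M]. *)
Lemma coef_le (R : realType) (K c D M p q : R) : `|c| <= K -> 0 <= p -> p <= D * q ->
  0 <= q -> 0 <= D -> K * D <= M -> c * p <= M * q.
Proof.
move=> cK p0 pq q0 D0 KM.
apply: (@le_trans _ _ (K * p)); first by rewrite ler_wpM2r// (le_trans (ler_norm c)).
apply: (@le_trans _ _ (K * (D * q))).
  by rewrite ler_wpM2l// (le_trans _ cK).
by rewrite mulrA ler_wpM2r.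
Qed.

Theorem theorem3p2 (R : realType) (d m : nat) (d_gt0 : (0 < d)%N)
  (m_gt0 : (0 < m)%N) (T lambda : R) (T_gt0 : 0 < T) (lambda_ge0 : 0 <= lambda)
  (U : set 'rV[R]_m) (U_compact : compact U) (U_nonempty : U !=set0)
  (f : 'rV[R]_d -> 'rV[R]_m -> R -> 'rV[R]_d)
  (L : 'rV[R]_d -> 'rV[R]_m -> R -> R) (g : 'rV[R]_d -> R)
  (y : (R -> 'rV[R]_m) -> 'rV[R]_d -> R -> R -> 'rV[R]_d)
  (y_sol : is_solution_map T U f y)
  (f_cont : {within [set: 'rV[R]_d * 'rV[R]_m] `*` `[0, T],
     continuous (fun p : 'rV[R]_d * 'rV[R]_m * R => f p.1.1 p.1.2 p.2)})
  (L_cont : {within [set: 'rV[R]_d * 'rV[R]_m] `*` `[0, T],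
     continuous (fun p : 'rV[R]_d * 'rV[R]_m * R => L p.1.1 p.1.2 p.2)})
  (g_cont : continuous g)
  (M_f M_L M_g L_f L_L L_g C_L C_g L_f' C_f : R)
  (f_bound : forall (x : 'rV[R]_d) (u : 'rV[R]_m) (s : R),
     U u -> 0 <= s <= T -> enorm (f x u s) <= M_f)
  (L_bound : forall (x : 'rV[R]_d) (u : 'rV[R]_m) (s : R),
     U u -> 0 <= s <= T -> `|L x u s| <= M_L)
  (g_bound : forall x, `|g x| <= M_g)
  (f_lip : forall (x z : 'rV[R]_d) (u : 'rV[R]_m) (s : R),
     U u -> 0 <= s <= T -> enorm (f x u s - f z u s) <= L_f * enorm (x - z))
  (L_lip : forall (x z : 'rV[R]_d) (u : 'rV[R]_m) (s : R),
     U u -> 0 <= s <= T -> `|L x u s - L z u s| <= L_L * enorm (x - z))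
  (g_lip : forall x z : 'rV[R]_d, `|g x - g z| <= L_g * enorm (x - z))
  (L_semiconcave : forall (x z : 'rV[R]_d) (u : 'rV[R]_m) (t tau : R),
     U u -> 0 <= t <= T -> 0 < tau ->
     0 <= t - tau <= T -> 0 <= t + tau <= T ->
     L (x + z) u (t + tau) - 2 * L x u t + L (x - z) u (t - tau)
       <= C_L * (enorm z ^+ 2 + tau ^+ 2))
  (g_semiconcave : forall x z : 'rV[R]_d,
     g (x + z) - 2 * g x + g (x - z) <= C_g * enorm z ^+ 2)
  (f_lip_space_time : forall (x z : 'rV[R]_d) (u : 'rV[R]_m) (t s : R),
     U u -> 0 <= t <= T -> 0 <= s <= T ->
     enorm (f x u t - f z u s) <= L_f' * (enorm (x - z) + `|t - s|))
  (f_second_diff : forall (x z : 'rV[R]_d) (u : 'rV[R]_m) (t tau : R),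
     U u -> 0 <= t <= T -> 0 < tau ->
     0 <= t - tau <= T -> 0 <= t + tau <= T ->
     enorm (f (x + z) u (t + tau) - 2 *: f x u t + f (x - z) u (t - tau))
       <= C_f * (enorm z ^+ 2 + tau ^+ 2)) :
  exists C : R, forall N : nat, (0 < N)%N ->
    (ereal_sup [set (discrete_value T lambda U f L g N p.1 p.2
                     - value T lambda U L g y p.1 p.2)%:E
               | p in [set: 'rV[R]_d] `*` `[0%R, T]]
     <= (C * time_step T N)%:E)%E.
Proof.
(* [D] dominates 1, [d] and [d ^ 2], hence every factor lost between the two norms, squared or
   not. *)
pose D : R := (d%:R + 1) ^+ 2.
pose cs := [:: M_f; M_L; M_g; L_f; L_L; L_g; C_L; C_g; L_f'; C_f].
pose K := \sum_(c <- cs) `|c|.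
(* The slope constant of [semiconcave_decrease] and [semiconcave_increase] for [L] as a function of
   time. *)
pose B := 8 * `|M_L| / T + `|C_L| * T.
pose M := 1 + K * D + B.
have d0 : 0 <= d%:R :> R by [].
have D1 : 1 <= D by rewrite /D; nra.
have dD : d%:R <= D by rewrite /D; nra.
have ddD : d%:R ^+ 2 <= D by rewrite /D; nra.
have dpD : d%:R + 1 <= D by rewrite /D; nra.
have D0 : 0 <= D by lra.
have K0 : 0 <= K by exact: sumr_ge0.
have Kc c : c \in cs -> `|c| <= K.
  move=> ccs; rewrite /K (big_rem c ccs) /= lerDl.
  by apply: sumr_ge0.
have B0 : 0 <= B by rewrite /B addr_ge0 ?divr_ge0 ?mulr_ge0// ltW.
have KD0 : 0 <= K * D by exact: mulr_ge0.
have KM : K * D <= M by rewrite /M; lra.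
have BM : B <= M by rewrite /M; lra.
have M0 : 0 < M by rewrite /M; lra.
have coef_norm c (x : 'rV[R]_d) : `|c| <= K -> c * enorm x <= M * `|x|.
  move=> cK; apply: (coef_le cK (enorm_ge0 x) _ _ D0 KM) => //.
  by apply: (le_trans (enorm_le_norm x)); rewrite ler_wpM2r.
have coef_sq c (x : 'rV[R]_d) : `|c| <= K -> c * enorm x ^+ 2 <= M * `|x| ^+ 2.
  move=> cK; apply: (coef_le cK _ _ _ D0 KM); rewrite ?exprn_ge0 ?enorm_ge0//.
  apply: (@le_trans _ _ ((d%:R * `|x|) ^+ 2)).
    by rewrite lerXn2r ?nnegrE ?mulr_ge0 ?enorm_ge0// enorm_le_norm.
  by rewrite exprMn ler_wpM2r ?exprn_ge0.
have coef1 c : `|c| <= K -> c <= M.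
  by move=> cK; have := coef_le cK ler01 (_ : 1 <= D * 1) ler01 D0 KM; rewrite !mulr1; apply.
have [KMf KML KMg] : [/\ `|M_f| <= K, `|M_L| <= K & `|M_g| <= K].
  by split; apply: Kc; rewrite !inE eqxx ?orbT.
have [KLf KLL KLg KLf'] : [/\ `|L_f| <= K, `|L_L| <= K, `|L_g| <= K & `|L_f'| <= K].
  by split; apply: Kc; rewrite !inE eqxx ?orbT.
have [KCL KCg KCf] : [/\ `|C_L| <= K, `|C_g| <= K & `|C_f| <= K].
  by split; apply: Kc; rewrite !inE eqxx ?orbT.
clearbody cs.
have KCL' : `| `|C_L| | <= K by rewrite normr_id.
have KCf' : `| `|C_f| | <= K by rewrite normr_id.
have L_bound' x u s : U u -> 0 <= s <= T -> `|L x u s| <= M.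
  by move=> Uu sT; apply: (le_trans (L_bound x u s Uu sT)); exact: coef1.
have g_bound' x : `|g x| <= M by apply: (le_trans (g_bound x)); exact: coef1.
have f_lip' x z u s : U u -> 0 <= s <= T -> `|f x u s - f z u s| <= M * `|x - z|.
  move=> Uu sT; apply: (le_trans (norm_le_enorm _)); apply: (le_trans (f_lip x z u s Uu sT)).
  exact: coef_norm.
have L_lip' x z u s : U u -> 0 <= s <= T -> `|L x u s - L z u s| <= M * `|x - z|.
  by move=> Uu sT; apply: (le_trans (L_lip x z u s Uu sT)); exact: coef_norm.
have g_lip' x z : `|g x - g z| <= M * `|x - z|.
  by apply: (le_trans (g_lip x z)); exact: coef_norm.
have f_bound' x u s : U u -> 0 <= s <= T -> `|f x u s| <= M.
  move=> Uu sT; apply: (le_trans (norm_le_enorm _)); apply: (le_trans (f_bound x u s Uu sT)).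
  exact: coef1.
have f_lip_time' x z u s t : U u -> 0 <= s <= T -> 0 <= t <= T ->
    `|f x u s - f z u t| <= M * (`|x - z| + `|s - t|).
  move=> Uu sT tT; apply: (le_trans (norm_le_enorm _)).
  apply: (le_trans (f_lip_space_time x z u s t Uu sT tT)).
  apply: (coef_le KLf' _ _ _ D0 KM); rewrite ?addr_ge0 ?enorm_ge0//.
  have h1 := enorm_le_norm (x - z).
  have h2 : d%:R * `|x - z| <= D * `|x - z| by rewrite ler_wpM2r.
  have h3 : 1 * `|s - t| <= D * `|s - t| by rewrite ler_wpM2r.
  by rewrite mulrDr; lra.
have f_second' x z u s : U u -> 0 < s < T ->
    `|f (x + z) u s - 2 *: f x u s + f (x - z) u s| <= M * `|z| ^+ 2.
  move=> Uu sT; apply: le_trans (coef_sq _ z KCf').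
  apply: (@spatial_second_diff _ _ _ T f `|C_f| M) => //; first exact: ltW.
    move=> x' t t' tT tT'; have := f_lip_time' x' x' u t t' Uu tT tT'.
    by rewrite subrr normr0 add0r.
  move=> tau tau0 h1 h2.
  apply: (le_trans (f_second_diff x z u s tau Uu _ tau0 h1 h2)); first by lra.
  by rewrite ler_wpM2r ?ler_norm// addr_ge0 ?exprn_ge0 ?enorm_ge0// ltW.
have L_sc' x z u s : U u -> 0 < s < T ->
    L (x + z) u s - 2 * L x u s + L (x - z) u s <= M * `|z| ^+ 2.
  move=> Uu sT; apply: le_trans (coef_sq _ z KCL').
  apply: (spatial_semiconcave (normr_ge0 C_L) L_cont) => //.
  move=> tau tau0 h1 h2.
  apply: (le_trans (L_semiconcave x z u s tau Uu _ tau0 h1 h2)); first by lra.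
  by rewrite ler_wpM2r ?ler_norm// addr_ge0 ?exprn_ge0 ?enorm_ge0// ltW.
have g_sc' x z : g (x + z) - 2 * g x + g (x - z) <= M * `|z| ^+ 2.
  by apply: (le_trans (g_semiconcave x z)); exact: coef_sq.
have L_time x u r tau : U u -> 0 <= r <= T -> 0 < tau -> 0 <= r - tau <= T ->
    0 <= r + tau <= T ->
    L x u (r + tau) - 2 * L x u r + L x u (r - tau) <= `|C_L| * tau ^+ 2.
  (* Semiconcavity in time alone is the case of a zero displacement in space. *)
  move=> Uu h1 h2 h3 h4; have := L_semiconcave x 0 u r tau Uu h1 h2 h3 h4.
  rewrite addr0 subr0 /enorm big1 => [|i _]; last by rewrite mxE expr0n.
  rewrite sqrtr0 expr0n add0r => /le_trans; apply.
  by rewrite ler_wpM2r ?exprn_ge0 ?ler_norm// ltW.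
have L_bd x u r : U u -> 0 <= r <= T -> `|L x u r| <= `|M_L|.
  by move=> Uu rT; apply: (le_trans (L_bound x u r Uu rT)); exact: ler_norm.
have L_decrease x u t s : U u -> 0 <= t <= T / 2 -> t <= s <= T ->
    L x u t - L x u s <= M * (s - t).
  move=> Uu tT ts; apply: (@le_trans _ _ (B * (s - t))).
    apply: (@semiconcave_decrease _ T `|M_L| `|C_L|) => //.
      by move=> r; exact: L_bd.
    by move=> r tau; exact: L_time.
  by rewrite ler_wpM2r// subr_ge0; case/andP: ts.
have L_increase x u t s : U u -> T / 2 <= t <= T -> 0 <= s <= t ->
    L x u t - L x u s <= M * (t - s).
  move=> Uu tT ts; apply: (@le_trans _ _ (B * (t - s))).
    apply: (@semiconcave_increase _ T `|M_L| `|C_L|) => //.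
      by move=> r; exact: L_bd.
    by move=> r tau; exact: L_time.
  by rewrite ler_wpM2r// subr_ge0; case/andP: ts.
(* [N] does not enter [total_const], so that the witness can be given before [N] is introduced. *)
exists (@total_const R d T lambda M * expR (lambda * T)) => N N_gt0.
apply: ge_ereal_sup => _ [[x t] [_ /= tT] <-]; rewrite in_itv /= in tT.
(* It is enough to bound the cost of each control from below; a constant control shows that the set
   of costs is nonempty. *)
rewrite lee_fin lerBlDr -lerBlDl; apply: lb_le_inf => [|_ [u u_adm <-]].
  have [v Uv] := U_nonempty.
  by exists (cost T lambda L g y x t (fun=> v)), (fun=> v).
rewrite lerBlDr.
exact: (discrete_value_le_cost T_gt0 lambda_ge0 M0 N_gt0 L_bound' g_bound' f_lip'
  L_lip' g_lip' f_second' L_sc' g_sc' U_nonempty f_bound' f_lip_time' L_decrease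
  L_increase x L_cont y_sol tT u_adm).
Qed.
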